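(* Let $d:S^1\times S^1\to\mathbb{R}$ be a metric on the circle $S^1$ such that $d\le d_{S^1}$ pointwise and $d\neq d_{S^1}$. Then $\mathrm{Fill}(d)<2\pi$.
   Context: $d_{S^1}$ denotes the angular (intrinsic) metric on the unit circle $S^1$, so $S^1$ has length $2\pi$. For a Riemannian metric $g$ on the closed disc $D^2$, the boundary distance function $\mathrm{bd}_g:S^1\times S^1\to\mathbb{R}$ assigns to two boundary points their distance in $(D^2,g)$, and $\mathrm{Area}(g)$ is the Riemannian area of $D^2$. For a metric $d$ on $S^1$ the filling area is $\mathrm{Fill}(d):=\inf_g \mathrm{Area}(g)$, where $g$ ranges over all Riemannian metrics on $D^2$ with $\mathrm{bd}_g\ge d$ pointwise. (By Pu's inequality, $\mathrm{Fill}(d_{S^1})=2\pi$.) *)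

(* Defs.v *)
From Stdlib Require Import Reals.
From Coquelicot Require Import Coquelicot.
Open Scope R_scope.

Definition in_disc (p : R * R) : Prop := fst p ^ 2 + snd p ^ 2 <= 1.
Definition on_circle (p : R * R) : Prop := fst p ^ 2 + snd p ^ 2 = 1.

Definition d_S1 (p q : R * R) : R := acos (fst p * fst q + snd p * snd q).

Definition is_metric_S1 (d : R * R -> R * R -> R) : Prop :=
  (forall p q, on_circle p -> on_circle q -> 0 <= d p q) /\
  (forall p q, on_circle p -> on_circle q -> (d p q = 0 <-> p = q)) /\
  (forall p q, on_circle p -> on_circle q -> d p q = d q p) /\
  (forall p q r, on_circle p -> on_circle q -> on_circle r ->
      d p r <= d p q + d q r).

Fixpoint Ck (k : nat) (f : R -> R -> R) : Prop :=
  (forall x y, continuous (fun p : R * R => f (fst p) (snd p)) (x, y)) /\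
  match k with
  | O => True
  | S k' =>
      (forall x y, ex_derive (fun t => f t y) x /\ ex_derive (fun t => f x t) y) /\
      Ck k' (fun x y => Derive (fun t => f t y) x) /\
      Ck k' (fun x y => Derive (fun t => f x t) y)
  end.

Definition smooth2 (f : R -> R -> R) : Prop := forall k, Ck k f.

(** A Riemannian metric g = E dx^2 + 2F dx dy + G dy^2 on the closed disc D^2,
    written in the standard global chart.  Smoothness up to the boundary is
    expressed (as usual, via Seeley extension) by the coefficients being the
    restrictions of smooth functions on R^2; positive definiteness is required
    at every point of the closed disc. *)
Record metric_tensor := MkTensor { gE : R -> R -> R; gF : R -> R -> R; gG : R -> R -> R }.

Definition riemannian_disc (g : metric_tensor) : Prop :=
  smooth2 (gE g) /\ smooth2 (gF g) /\ smooth2 (gG g) /\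
  (forall x y, in_disc (x, y) ->
     0 < gE g x y /\ 0 < gE g x y * gG g x y - gF g x y ^ 2).

Definition C1_curve (c1 c2 : R -> R) : Prop :=
  (forall t, ex_derive c1 t /\ ex_derive c2 t) /\
  (forall t, continuous (Derive c1) t /\ continuous (Derive c2) t).

Definition curve_in_disc (c1 c2 : R -> R) (p q : R * R) : Prop :=
  C1_curve c1 c2 /\ (forall t, 0 <= t <= 1 -> in_disc (c1 t, c2 t)) /\
  (c1 0, c2 0) = p /\ (c1 1, c2 1) = q.

Definition curve_length (g : metric_tensor) (c1 c2 : R -> R) : R :=
  RInt (fun t =>
    let x := c1 t in let y := c2 t in
    let u := Derive c1 t in let v := Derive c2 t in
    sqrt (gE g x y * u ^ 2 + 2 * gF g x y * u * v + gG g x y * v ^ 2)) 0 1.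

Definition dist_g (g : metric_tensor) (p q : R * R) : Rbar :=
  Glb_Rbar (fun L => exists c1 c2, curve_in_disc c1 c2 p q /\ L = curve_length g c1 c2).

Definition area_g (g : metric_tensor) : R :=
  RInt (fun x =>
    RInt (fun y => sqrt (gE g x y * gG g x y - gF g x y ^ 2))
         (- sqrt (1 - x ^ 2)) (sqrt (1 - x ^ 2))) (-1) 1.

Definition Fill (d : R * R -> R * R -> R) : Rbar :=
  Glb_Rbar (fun A => exists g : metric_tensor,
    riemannian_disc g /\
    (forall p q, on_circle p -> on_circle q -> Rbar_le (Finite (d p q)) (dist_g g p q)) /\
    A = area_g g).

(* Main.v *)
(** A metric [d <= d_S1] other than [d_S1] has an antipodal pair [p0, -p0] with
    [d p0 (-p0) < PI], hence slack for all nearly antipodal pairs close to it.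
    The round hemisphere is perturbed conformally to [1 + 2 e phi + C e^2 z^2],
    where [phi] has negative mean but nonnegative integral over every great
    semicircle whose endpoints are not close to [p0, -p0].  In the gnomonic
    chart (great circles become lines) [phi] comes from
    [B_yy + K N] with [B = 1 / (1 + l x^2 + y^2)] and [N >= max (0, - B_xx)]:
    along a line of direction [(c, s)], [B_yy] is a derivative plus
    [(c/s)^2 B_xx], whereas integrating [B_yy] by parts in [y] against the
    weight of the area form gives a negative quantity, which dominates as
    [l -> 0].  Lengths are bounded below by calibrations
    [asin <P, th> + e a], [a] being the primitive of [phi] minus a nonnegative
    function along the semicircles through [th]; both summands are known at
    the boundary, so no geodesic has to be computed. *)
Require Import Defs.
From Stdlib Require Import Reals Lra Psatz FunctionalExtensionality.
From Coquelicot Require Import Coquelicot.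
Open Scope R_scope.

(** * Smooth functions of two variables *)

(** If the integral of [phi] over every great semicircle were nonnegative, so would be its mean, a
    positive multiple of the average over all semicircles. The exceptional directions near [p0] are
    what makes a loss of area possible. The mechanism is a mismatch of weights: with
    [w = 1 / sqrt (1 + x^2 + y^2)], the third coordinate in the gnomonic chart, arclength on a line
    is a constant times [w^2 dt], while area is [w^3 dx dy]. Since [phi] is [B_yy + K N] divided by
    [w^2], its integrals along lines carry no variable weight, but its area integral carries [w].
    Absorbing [(c/s)^2 B_xx] into [K N] requires [K >= (c/s)^2], which fails as [s] tends to 0;
    hence the threshold [|s| >= s0] and the choice [K = 1 / s0^2]. For pairs near the exceptional
    axis a crude comparison with the round metric suffices, because [d] itself has slack there. In
    dimension two the area density of a conformal metric is the factor itself, so [phi] enters the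
    area only through its integral. *)

Lemma Ck_pred (k : nat) (f : R -> R -> R) : Ck (S k) f -> Ck k f.
Proof.
  revert f; induction k as [|k IH]; intros f [Hc [Hd [Hx Hy]]].
  - split; auto.
  - split; [assumption|]. split; [assumption|]. split; apply IH; assumption.
Qed.

Lemma Ck_const (k : nat) (c : R) : Ck k (fun _ _ => c).
Proof.
  revert c; induction k as [|k IH]; intros c; (split; [intros; apply continuous_const|]).
  - exact I.
  - split; [intros x y; split; apply ex_derive_const|].
    split; (replace (fun x y : R => Derive _ _) with (fun _ _ : R => 0); [apply IH|]);
    do 2 (apply functional_extensionality; intro); symmetry; apply Derive_const.
Qed.

Lemma Ck_fst (k : nat) : Ck k (fun x _ => x).
Proof.
  destruct k as [|k]; (split; [intros x y; exact (continuous_fst x y)|]).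
  - exact I.
  - split; [intros x y; split; [apply ex_derive_id | apply ex_derive_const]|].
    split.
    + replace (fun x y : R => Derive (fun t => t) x) with (fun _ _ : R => 1); [apply Ck_const|].
      do 2 (apply functional_extensionality; intro). symmetry; apply Derive_id.
    + replace (fun x y : R => Derive (fun t => x) y) with (fun _ _ : R => 0); [apply Ck_const|].
      do 2 (apply functional_extensionality; intro). symmetry; apply Derive_const.
Qed.

Lemma Ck_snd (k : nat) : Ck k (fun _ y => y).
Proof.
  destruct k as [|k]; (split; [intros x y; exact (continuous_snd x y)|]).
  - exact I.
  - split; [intros x y; split; [apply ex_derive_const | apply ex_derive_id]|].
    split.
    + replace (fun x y : R => Derive (fun t => y) x) with (fun _ _ : R => 0); [apply Ck_const|].
      do 2 (apply functional_extensionality; intro). symmetry; apply Derive_const.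
    + replace (fun x y : R => Derive (fun t => t) y) with (fun _ _ : R => 1); [apply Ck_const|].
      do 2 (apply functional_extensionality; intro). symmetry; apply Derive_id.
Qed.

Lemma Ck_plus (k : nat) (f g : R -> R -> R) :
  Ck k f -> Ck k g -> Ck k (fun x y => f x y + g x y).
Proof.
  revert f g; induction k as [|k IH]; intros f g [Hf Kf] [Hg Kg].
  - split; [|exact I]. intros x y. apply (continuous_plus (V := R_NormedModule)); auto.
  - split; [intros x y; apply (continuous_plus (V := R_NormedModule)); auto|].
    destruct Kf as [df [fx fy]], Kg as [dg [gx gy]].
    split; [|split].
    + intros x y. destruct (df x y), (dg x y).
      split; apply (ex_derive_plus (V := R_NormedModule)); auto.
    + replace (fun x y : R => Derive (fun t => f t y + g t y) x)
        with (fun x y => Derive (fun t => f t y) x + Derive (fun t => g t y) x);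
        [apply (IH _ _ fx gx)|].
      apply functional_extensionality; intro u; apply functional_extensionality; intro v. symmetry.
      apply (Derive_plus (fun t => f t v) (fun t => g t v)); [exact (proj1 (df u v)) | exact (proj1 (dg u v))].
    + replace (fun x y : R => Derive (fun t => f x t + g x t) y)
        with (fun x y => Derive (fun t => f x t) y + Derive (fun t => g x t) y);
        [apply (IH _ _ fy gy)|].
      apply functional_extensionality; intro u; apply functional_extensionality; intro v. symmetry.
      apply (Derive_plus (f u) (g u)); [exact (proj2 (df u v)) | exact (proj2 (dg u v))].
Qed.

Lemma Ck_mult (k : nat) (f g : R -> R -> R) :
  Ck k f -> Ck k g -> Ck k (fun x y => f x y * g x y).
Proof.
  revert f g; induction k as [|k IH]; intros f g Kf Kg.
  - destruct Kf as [Hf _], Kg as [Hg _]. split; [|exact I].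
    intros x y. apply (continuous_mult (K := R_AbsRing)); auto.
  (* The product rule leaves one factor undifferentiated, so both functions are also needed at order
     [k]. *)
  - pose proof (Ck_pred _ _ Kf) as Pf. pose proof (Ck_pred _ _ Kg) as Pg.
    destruct Kf as [Hf [df [fx fy]]], Kg as [Hg [dg [gx gy]]].
    split; [intros x y; apply (continuous_mult (K := R_AbsRing)); auto|].
    split; [|split].
    + intros x y. destruct (df x y), (dg x y). split; apply ex_derive_mult; auto.
    + replace (fun x y : R => Derive (fun t => f t y * g t y) x)
        with (fun x y => Derive (fun t => f t y) x * g x y + f x y * Derive (fun t => g t y) x);
        [apply Ck_plus; apply IH; assumption|].
      apply functional_extensionality; intro u; apply functional_extensionality; intro v. symmetry.
      apply (Derive_mult (fun t => f t v) (fun t => g t v)); [exact (proj1 (df u v)) | exact (proj1 (dg u v))].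
    + replace (fun x y : R => Derive (fun t => f x t * g x t) y)
        with (fun x y => Derive (fun t => f x t) y * g x y + f x y * Derive (fun t => g x t) y);
        [apply Ck_plus; apply IH; assumption|].
      apply functional_extensionality; intro u; apply functional_extensionality; intro v. symmetry.
      apply (Derive_mult (f u) (g u)); [exact (proj2 (df u v)) | exact (proj2 (dg u v))].
Qed.

Lemma Ck_inv (k : nat) (f : R -> R -> R) :
  (forall x y, f x y <> 0) -> Ck k f -> Ck k (fun x y => / f x y).
Proof.
  intros Hn; induction k as [|k IH]; intros Kf.
  - destruct Kf as [Hf _]. split; [|exact I].
    intros x y. apply (continuous_comp (fun p : R * R => f (fst p) (snd p)) Rinv);
      [apply Hf | apply continuous_Rinv, Hn].
  - pose proof (IH (Ck_pred _ _ Kf)) as Pi.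
    destruct Kf as [Hf [df [fx fy]]].
    split; [intros x y; apply (continuous_comp (fun p : R * R => f (fst p) (snd p)) Rinv);
      [apply Hf | apply continuous_Rinv, Hn]|].
    split; [|split].
    + intros x y. destruct (df x y). split; apply ex_derive_inv; auto.
    + replace (fun x y : R => Derive (fun t => / f t y) x)
        with (fun x y => (-1) * Derive (fun t => f t y) x * (/ f x y * / f x y));
        [apply Ck_mult; [apply Ck_mult; [apply Ck_const | exact fx] | apply Ck_mult; exact Pi]|].
      apply functional_extensionality; intro u; apply functional_extensionality; intro v.
      rewrite (Derive_inv (fun t => f t v)); [field; apply Hn | exact (proj1 (df u v)) | apply Hn].
    + replace (fun x y : R => Derive (fun t => / f x t) y)
        with (fun x y => (-1) * Derive (fun t => f x t) y * (/ f x y * / f x y));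
        [apply Ck_mult; [apply Ck_mult; [apply Ck_const | exact fy] | apply Ck_mult; exact Pi]|].
      apply functional_extensionality; intro u; apply functional_extensionality; intro v.
      rewrite (Derive_inv (fun t => f u t)); [field; apply Hn | exact (proj2 (df u v)) | apply Hn].
Qed.

Lemma smooth2_const (c : R) : smooth2 (fun _ _ => c).
Proof. intro k; apply Ck_const. Qed.

Lemma smooth2_fst : smooth2 (fun x _ => x).
Proof. intro k; apply Ck_fst. Qed.

Lemma smooth2_snd : smooth2 (fun _ y => y).
Proof. intro k; apply Ck_snd. Qed.

Lemma smooth2_plus (f g : R -> R -> R) :
  smooth2 f -> smooth2 g -> smooth2 (fun x y => f x y + g x y).
Proof. intros Hf Hg k; apply Ck_plus; auto. Qed.

Lemma smooth2_mult (f g : R -> R -> R) :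
  smooth2 f -> smooth2 g -> smooth2 (fun x y => f x y * g x y).
Proof. intros Hf Hg k; apply Ck_mult; auto. Qed.

Lemma smooth2_inv (f : R -> R -> R) :
  (forall x y, f x y <> 0) -> smooth2 f -> smooth2 (fun x y => / f x y).
Proof. intros Hn Hf k; apply Ck_inv; auto. Qed.

Lemma smooth2_opp (f : R -> R -> R) : smooth2 f -> smooth2 (fun x y => - f x y).
Proof.
  intros Hf. replace (fun x y => - f x y) with (fun x y => (-1) * f x y).
  - apply smooth2_mult; [apply smooth2_const | exact Hf].
  - do 2 (apply functional_extensionality; intro); ring.
Qed.

Lemma smooth2_minus (f g : R -> R -> R) :
  smooth2 f -> smooth2 g -> smooth2 (fun x y => f x y - g x y).
Proof. intros Hf Hg; apply smooth2_plus; [|apply smooth2_opp]; assumption. Qed.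

Lemma smooth2_pow (n : nat) (f : R -> R -> R) : smooth2 f -> smooth2 (fun x y => f x y ^ n).
Proof.
  intros Hf; induction n as [|n IH]; simpl; [apply smooth2_const|].
  apply smooth2_mult; assumption.
Qed.

Lemma smooth2_div (f g : R -> R -> R) :
  (forall x y, g x y <> 0) -> smooth2 f -> smooth2 g -> smooth2 (fun x y => f x y / g x y).
Proof. intros Hn Hf Hg; apply smooth2_mult; [|apply smooth2_inv]; assumption. Qed.

Definition continuous2 (f : R -> R -> R) : Prop :=
  forall x y, continuous (fun p : R * R => f (fst p) (snd p)) (x, y).

Lemma smooth2_continuous2 (f : R -> R -> R) : smooth2 f -> continuous2 f.
Proof. intros Hf; exact (proj1 (Hf O)). Qed.

Lemma smooth2_ex_derive (f : R -> R -> R) : smooth2 f ->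
  forall x y, ex_derive (fun t => f t y) x /\ ex_derive (fun t => f x t) y.
Proof. intros Hf; exact (proj1 (proj2 (Hf 1%nat))). Qed.

Lemma smooth2_Derive_fst (f : R -> R -> R) :
  smooth2 f -> smooth2 (fun x y => Derive (fun t => f t y) x).
Proof. intros Hf k; exact (proj1 (proj2 (proj2 (Hf (S k))))). Qed.

Lemma smooth2_Derive_snd (f : R -> R -> R) :
  smooth2 f -> smooth2 (fun x y => Derive (fun t => f x t) y).
Proof. intros Hf k; exact (proj2 (proj2 (proj2 (Hf (S k))))). Qed.

Lemma continuous2_mult (f g : R -> R -> R) :
  continuous2 f -> continuous2 g -> continuous2 (fun x y => f x y * g x y).
Proof. intros Hf Hg x y. apply (continuous_mult (K := R_AbsRing)); auto. Qed.

Lemma continuous2_plus (f g : R -> R -> R) :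
  continuous2 f -> continuous2 g -> continuous2 (fun x y => f x y + g x y).
Proof. intros Hf Hg x y. apply (continuous_plus (V := R_NormedModule)); auto. Qed.

Lemma continuous2_comp (f g h : R -> R -> R) :
  continuous2 f -> continuous2 g -> continuous2 h ->
  continuous2 (fun x y => f (g x y) (h x y)).
Proof.
  intros Hf Hg Hh x y.
  apply (continuous_comp_2 (fun p : R * R => g (fst p) (snd p))
    (fun p : R * R => h (fst p) (snd p)) f); auto.
Qed.

Lemma continuous2_section (f : R -> R -> R) (x y : R) :
  continuous2 f -> continuous (f x) y.
Proof.
  intros Hf.
  apply (continuous_comp_2 (fun _ : R => x) (fun t : R => t) f);
    [apply continuous_const | apply continuous_id | apply Hf].
Qed.

Lemma continuous2_of_fst (g : R -> R) :
  (forall x, continuous g x) -> continuous2 (fun x _ => g x).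
Proof.
  intros Hg x y. apply (continuous_comp (fun p : R * R => fst p) g);
    [exact (continuous_fst x y) | apply Hg].
Qed.

Lemma continuous2_continuity_2d_pt (f : R -> R -> R) (x y : R) :
  continuous2 f -> continuity_2d_pt f x y.
Proof. intros Hf; apply continuity_2d_pt_filterlim, Hf. Qed.

Lemma continuous2_ex_RInt (f : R -> R -> R) (x a b : R) : continuous2 f -> ex_RInt (f x) a b.
Proof.
  intros Hf. apply (ex_RInt_continuous (V := R_CompleteNormedModule)).
  intros; apply continuous2_section; assumption.
Qed.

Lemma continuous_RInt_param (f : R -> R -> R) (a b x : R) :
  a <= b -> continuous2 f -> continuous (fun x => RInt (f x) a b) x.
Proof.
  intros Hab Hf.
  apply continuity_pt_filterlim. intros eps Heps.
  (* The [+ 1] covers [a = b] and makes the final estimate strict. *)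
  assert (He : 0 < eps / (b - a + 1)) by (apply Rdiv_lt_0_compat; lra).
  destruct (uniform_continuity_2d_1d' f a b x
    (fun t _ => continuous2_continuity_2d_pt f x t Hf) (mkposreal _ He)) as [d Hd].
  exists d; split; [apply cond_pos|].
  intros y [_ Hy]. unfold dist in *; simpl in *; unfold Rdist in *.
  pose proof (cond_pos d) as Hdp.
  apply Rabs_def2 in Hy.
  pose proof (RInt_minus (V := R_CompleteNormedModule) (f y) (f x) a b
    (continuous2_ex_RInt f y a b Hf) (continuous2_ex_RInt f x a b Hf)) as Hm.
  change (RInt (fun t => minus (f y t) (f x t)) a b = RInt (f y) a b - RInt (f x) a b) in Hm.
  rewrite <- Hm.
  apply Rle_lt_trans with (RInt (fun _ => eps / (b - a + 1)) a b).
  - eapply Rle_trans; [apply abs_RInt_le; [exact Hab|]|].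
    + apply (ex_RInt_minus (V := R_NormedModule)); apply continuous2_ex_RInt; assumption.
    + apply RInt_le; [exact Hab| | apply ex_RInt_const |].
      * apply (ex_RInt_continuous (V := R_CompleteNormedModule)); intros t _.
        apply (continuous_comp (fun t => minus (f y t) (f x t)) Rabs);
          [|apply continuous_Rabs].
        apply (continuous_minus (V := R_NormedModule)); apply continuous2_section; assumption.
      * intros t Ht. apply Rlt_le.
        apply (Hd t x t y); try lra. rewrite Rminus_diag, Rabs_R0; lra.
  - rewrite RInt_const. unfold scal; simpl; unfold mult; simpl.
    replace ((b - a) * (eps / (b - a + 1))) with (eps * ((b - a) / (b - a + 1))) by (field; lra).
    assert ((b - a) / (b - a + 1) < 1) by (apply Rlt_div_l; lra). nra.
Qed.

(** * Integration over the disc *)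

Definition chord (x : R) : R := sqrt (1 - x ^ 2).

Definition disc_int (f : R -> R -> R) : R :=
  RInt (fun x => RInt (f x) (- chord x) (chord x)) (-1) 1.

Lemma chord_pos (x : R) : 0 <= chord x.
Proof. apply sqrt_pos. Qed.

Lemma chord_sqr (x : R) : -1 <= x <= 1 -> chord x ^ 2 = 1 - x ^ 2.
Proof. intros Hx; unfold chord; rewrite pow2_sqrt; nra. Qed.

Lemma chord_le_1 (x : R) : chord x <= 1.
Proof. unfold chord. rewrite <- sqrt_1 at 2. apply sqrt_le_1_alt; nra. Qed.

Lemma chord_continuous (x : R) : continuous chord x.
Proof.
  apply continuous_sqrt_comp. apply (continuous_minus (V := R_NormedModule)).
  - apply continuous_const.
  - apply (ex_derive_continuous (V := R_NormedModule)). auto_derive; exact I.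
Qed.

Lemma chord_interior (x y : R) :
  -1 <= x <= 1 -> - chord x <= y <= chord x -> x ^ 2 + y ^ 2 <= 1.
Proof. intros Hx Hy. pose proof (chord_sqr x Hx). nra. Qed.

(* The substitution [y = chord x * t] makes the limits of integration constant. *)
Lemma continuous_inner (f : R -> R -> R) (x : R) :
  continuous2 f -> continuous (fun x => RInt (f x) (- chord x) (chord x)) x.
Proof.
  intros Hf.
  apply (continuous_ext (fun x => RInt (fun t => chord x * f x (chord x * t)) (-1) 1)).
  - intros u.
    pose proof (RInt_comp_lin (V := R_CompleteNormedModule) (f u) (chord u) 0 (-1) 1
      (continuous2_ex_RInt f u _ _ Hf)) as H.
    replace (chord u * -1 + 0) with (- chord u) in H by ring.
    replace (chord u * 1 + 0) with (chord u) in H by ring.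
    rewrite <- H. apply RInt_ext. intros t _.
    unfold scal; simpl; unfold mult; simpl. rewrite Rplus_0_r; reflexivity.
  - assert (Hc : continuous2 (fun x _ => chord x)) by (apply continuous2_of_fst, chord_continuous).
    assert (Ht : continuous2 (fun _ t => t)) by (intros u v; exact (continuous_snd u v)).
    assert (Hx : continuous2 (fun x _ => x)) by (intros u v; exact (continuous_fst u v)).
    apply (continuous_RInt_param (fun x t => chord x * f x (chord x * t))); [lra|].
    apply continuous2_mult; [exact Hc|].
    apply (continuous2_comp f (fun x _ => x) (fun x t => chord x * t) Hf Hx).
    apply continuous2_mult; assumption.
Qed.

Lemma ex_RInt_inner (f : R -> R -> R) (a b : R) :
  continuous2 f -> ex_RInt (fun x => RInt (f x) (- chord x) (chord x)) a b.
Proof.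
  intros Hf. apply (ex_RInt_continuous (V := R_CompleteNormedModule)).
  intros; apply continuous_inner; assumption.
Qed.

Lemma chord_ord (x : R) : - chord x <= chord x.
Proof. pose proof (chord_pos x); lra. Qed.

Lemma disc_int_ext (f g : R -> R -> R) :
  (forall x y, x ^ 2 + y ^ 2 <= 1 -> f x y = g x y) -> disc_int f = disc_int g.
Proof.
  intros H. apply RInt_ext. intros x Hx. rewrite Rmin_left, Rmax_right in Hx by lra.
  apply RInt_ext. intros y Hy. pose proof (chord_ord x).
  rewrite Rmin_left, Rmax_right in Hy by lra.
  apply H, chord_interior; lra.
Qed.

Lemma disc_int_plus (f g : R -> R -> R) : continuous2 f -> continuous2 g ->
  disc_int (fun x y => f x y + g x y) = disc_int f + disc_int g.
Proof.
  intros Hf Hg. unfold disc_int.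
  rewrite <- (RInt_plus (V := R_CompleteNormedModule) _ _ _ _
    (ex_RInt_inner f _ _ Hf) (ex_RInt_inner g _ _ Hg)).
  apply RInt_ext. intros x _.
  apply (RInt_plus (V := R_CompleteNormedModule) (f x) (g x)); apply continuous2_ex_RInt; assumption.
Qed.

Lemma disc_int_scal (c : R) (f : R -> R -> R) : continuous2 f ->
  disc_int (fun x y => c * f x y) = c * disc_int f.
Proof.
  intros Hf. unfold disc_int.
  rewrite <- (RInt_scal (V := R_CompleteNormedModule) _ _ _ c (ex_RInt_inner f _ _ Hf)).
  apply RInt_ext. intros x _.
  apply (RInt_scal (V := R_CompleteNormedModule) (f x)); apply continuous2_ex_RInt; assumption.
Qed.

Lemma disc_int_le (f g : R -> R -> R) : continuous2 f -> continuous2 g ->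
  (forall x y, x ^ 2 + y ^ 2 <= 1 -> f x y <= g x y) -> disc_int f <= disc_int g.
Proof.
  intros Hf Hg H. apply RInt_le; [lra | apply ex_RInt_inner; assumption
    | apply ex_RInt_inner; assumption |].
  intros x Hx. apply RInt_le; [apply chord_ord | apply continuous2_ex_RInt; assumption
    | apply continuous2_ex_RInt; assumption |].
  intros y Hy. apply H, chord_interior; lra.
Qed.

(** Vertical chords have length at most 2. This reduces a concentrated integral over the disc to a
    one-dimensional one with an explicit primitive. *)
Lemma disc_int_le_fst (f : R -> R -> R) (g : R -> R) :
  continuous2 f -> (forall x, continuous g x) -> (forall x, 0 <= g x) ->
  (forall x y, x ^ 2 + y ^ 2 <= 1 -> f x y <= g x) ->
  disc_int f <= 2 * RInt g (-1) 1.
Proof.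
  intros Hf Hg Hp H.
  assert (Eg : ex_RInt g (-1) 1)
    by (apply (ex_RInt_continuous (V := R_CompleteNormedModule)); intros; apply Hg).
  change (2 * RInt g (-1) 1) with (scal 2 (RInt g (-1) 1)).
  rewrite <- (RInt_scal (V := R_CompleteNormedModule) _ _ _ 2 Eg).
  apply RInt_le; [lra | apply ex_RInt_inner; assumption
    | apply (ex_RInt_scal (V := R_CompleteNormedModule)); exact Eg |].
  intros x Hx. apply Rle_trans with (RInt (fun _ => g x) (- chord x) (chord x)).
  - apply RInt_le; [apply chord_ord | apply continuous2_ex_RInt; assumption
      | apply ex_RInt_const |].
    intros y Hy. apply H, chord_interior; lra.
  - rewrite RInt_const. unfold scal; simpl; unfold mult; simpl.
    pose proof (chord_le_1 x). pose proof (Hp x). nra.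
Qed.

Lemma RInt_pos_at (f : R -> R) (a b x0 : R) : a < x0 < b ->
  (forall x, a <= x <= b -> continuous f x) -> (forall x, a < x < b -> 0 <= f x) ->
  0 < f x0 -> 0 < RInt f a b.
Proof.
  intros Hx0 Hc Hp H0.
  assert (Hl : locally x0 (fun x => 0 < f x)).
  { apply (Hc x0 ltac:(lra)), (open_gt 0); exact H0. }
  destruct Hl as [d Hd]. pose proof (cond_pos d) as Hdp.
  set (e := Rmin (d / 2) (Rmin ((x0 - a) / 2) ((b - x0) / 2))).
  assert (He : 0 < e) by (unfold e; repeat apply Rmin_glb_lt; lra).
  assert (He1 : e <= d / 2) by apply Rmin_l.
  assert (He2 : e <= (x0 - a) / 2) by (eapply Rle_trans; [apply Rmin_r | apply Rmin_l]).
  assert (He3 : e <= (b - x0) / 2) by (eapply Rle_trans; [apply Rmin_r | apply Rmin_r]).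
  assert (Ex : forall u v, a <= u -> u <= v -> v <= b -> ex_RInt f u v).
  { intros u v H1 H2 H3. apply (ex_RInt_continuous (V := R_CompleteNormedModule)).
    intros x Hx. rewrite Rmin_left, Rmax_right in Hx by lra. apply Hc; lra. }
  rewrite <- (RInt_Chasles (V := R_CompleteNormedModule) f a (x0 - e) b); [|apply Ex; lra|apply Ex; lra].
  rewrite <- (RInt_Chasles (V := R_CompleteNormedModule) f (x0 - e) (x0 + e) b); [|apply Ex; lra|apply Ex; lra].
  assert (0 <= RInt f a (x0 - e)) by (apply RInt_ge_0; [lra|apply Ex; lra|intros; apply Hp; lra]).
  assert (0 <= RInt f (x0 + e) b) by (apply RInt_ge_0; [lra|apply Ex; lra|intros; apply Hp; lra]).
  assert (0 < RInt f (x0 - e) (x0 + e)).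
  { apply RInt_gt_0; [lra | | intros; apply Hc; lra].
    intros x Hx. apply Hd. unfold ball; simpl; unfold AbsRing_ball, abs, minus, plus, opp; simpl.
    apply Rabs_def1; lra. }
  unfold plus; simpl. lra.
Qed.

Lemma disc_int_pos_at (f : R -> R -> R) (x0 y0 : R) : continuous2 f ->
  (forall x y, x ^ 2 + y ^ 2 <= 1 -> 0 <= f x y) ->
  x0 ^ 2 + y0 ^ 2 < 1 -> 0 < f x0 y0 -> 0 < disc_int f.
Proof.
  intros Hf Hp H1 H0.
  assert (Hx0 : -1 < x0 < 1) by nra.
  apply RInt_pos_at with x0; [exact Hx0 | intros; apply continuous_inner; exact Hf | |].
  - intros x Hx. apply RInt_ge_0; [apply chord_ord | apply continuous2_ex_RInt; exact Hf|].
    intros y Hy; apply Hp, chord_interior; lra.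
  - pose proof (chord_sqr x0 ltac:(lra)). pose proof (chord_pos x0).
    apply RInt_pos_at with y0; [nra | intros; apply continuous2_section; exact Hf | | exact H0].
    intros y Hy; apply Hp, chord_interior; lra.
Qed.

(** * The divergence theorem on the disc *)

Lemma disc_int_Derive_snd (f : R -> R -> R) : smooth2 f ->
  (forall x y, x ^ 2 + y ^ 2 = 1 -> f x y = 0) ->
  disc_int (fun x y => Derive (fun t => f x t) y) = 0.
Proof.
  intros Hf H0. unfold disc_int.
  rewrite (RInt_ext _ (fun _ => 0)).
  - rewrite RInt_const. unfold scal; simpl; unfold mult; simpl; ring.
  - intros x Hx. rewrite Rmin_left, Rmax_right in Hx by lra.
    pose proof (chord_sqr x ltac:(lra)).
    (* The inner integration is in [y], so the fundamental theorem on each vertical chord suffices;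
       the derivative in [x] is transverse to the chords and needs another argument. *)
    pose proof (RInt_Derive (f x) (- chord x) (chord x)) as HD.
    rewrite H0, H0 in HD by nra. rewrite Rminus_diag in HD.
    apply HD; intros y _.
    + apply (proj2 (smooth2_ex_derive f Hf x y)).
    + exact (continuous2_section _ x y (smooth2_continuous2 _ (smooth2_Derive_snd f Hf))).
Qed.

(** The square, unlike the positive part itself, is of class C^1 across 0; it extends [w^2] from the
    disc by zero. *)
Definition pos_sq (x : R) : R := Rmax 0 x ^ 2.

Lemma is_derive_pos_sq (x : R) : is_derive pos_sq x (2 * Rmax 0 x).
Proof.
  destruct (Rtotal_order x 0) as [Hx|[Hx|Hx]].
  - apply (is_derive_ext_loc (fun _ => 0)).
    + assert (Hl : locally x (fun t => t < 0)) by (apply (open_lt 0); exact Hx).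
      eapply filter_imp; [|exact Hl].
      intros t Ht. unfold pos_sq. rewrite Rmax_left by lra. change (0 = 0 ^ 2); ring.
    + rewrite Rmax_left by lra. rewrite Rmult_0_r. apply (is_derive_const (V := R_NormedModule)).
  - subst. rewrite Rmax_left, Rmult_0_r by lra. apply is_derive_Reals.
    intros e He. exists (mkposreal e He). intros h Hh Hhe. simpl in Hhe.
    unfold pos_sq. rewrite Rplus_0_l, (Rmax_left 0 0) by lra.
    destruct (Rle_dec h 0).
    + rewrite Rmax_left by lra. replace ((0 ^ 2 - 0 ^ 2) / h - 0) with 0 by (field; lra).
      rewrite Rabs_R0; exact He.
    + rewrite Rmax_right by lra. replace ((h ^ 2 - 0 ^ 2) / h - 0) with h by (field; lra).
      exact Hhe.
  - apply (is_derive_ext_loc (fun t => t ^ 2)).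
    + assert (Hl : locally x (fun t => 0 < t)) by (apply (open_gt 0); exact Hx).
      eapply filter_imp; [|exact Hl].
      intros t Ht. unfold pos_sq. rewrite Rmax_right by lra. reflexivity.
    + rewrite Rmax_right by lra. auto_derive; [exact I | ring].
Qed.

Lemma continuous_Rmax_0 (x : R) : continuous (Rmax 0) x.
Proof.
  apply (continuous_ext (fun t => (t + Rabs t) / 2)).
  - intros t. unfold Rmax, Rabs. destruct (Rle_dec 0 t), (Rcase_abs t); lra.
  - apply (continuous_mult (K := R_AbsRing)); [|apply continuous_const].
    apply (continuous_plus (V := R_NormedModule)); [apply continuous_id | apply continuous_Rabs].
Qed.

(* Extending [(1 - r^2)^2 h] by zero outside the disc keeps it of class C^1, so
   the integral may be taken over the square, where one can differentiate under
   the integral sign. *)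
Lemma disc_int_Derive_fst (h : R -> R -> R) : smooth2 h ->
  disc_int (fun x y => Derive (fun t => (1 - t ^ 2 - y ^ 2) ^ 2 * h t y) x) = 0.
Proof.
  intros Hh.
  set (w := fun x y : R => 1 - x ^ 2 - y ^ 2).
  set (F := fun x y => pos_sq (w x y) * h x y).
  set (dF := fun x y => -4 * x * Rmax 0 (w x y) * h x y
                        + pos_sq (w x y) * Derive (fun t => h t y) x).
  assert (HF : forall x y, is_derive (fun t => F t y) x (dF x y)).
  { intros x y. unfold F, dF.
    replace (-4 * x * Rmax 0 (w x y) * h x y + pos_sq (w x y) * Derive (fun t => h t y) x)
      with (((-2 * x) * (2 * Rmax 0 (w x y))) * h x y + pos_sq (w x y) * Derive (fun t => h t y) x) by ring.
    apply (is_derive_mult (fun t => pos_sq (w t y)) (fun t => h t y)).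
    - apply (is_derive_comp pos_sq (fun t => w t y)); [apply is_derive_pos_sq|].
      unfold w. auto_derive; [exact I | ring].
    - apply Derive_correct, (proj1 (smooth2_ex_derive h Hh x y)).
    - intros; apply Rmult_comm. }
  assert (Cw : continuous2 w).
  { apply smooth2_continuous2. unfold w.
    apply smooth2_minus; [apply smooth2_minus|];
      [apply smooth2_const | apply smooth2_pow, smooth2_fst | apply smooth2_pow, smooth2_snd]. }
  assert (Cm : continuous2 (fun x y => Rmax 0 (w x y))).
  { intros x y. apply (continuous_comp (fun p : R * R => w (fst p) (snd p)) (Rmax 0));
      [apply Cw | apply continuous_Rmax_0]. }
  assert (Cp : continuous2 (fun x y => pos_sq (w x y))).
  { intros x y. apply (continuous_comp (fun p : R * R => w (fst p) (snd p)) pos_sq);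
      [apply Cw |]. apply (ex_derive_continuous (V := R_NormedModule)).
    eexists; apply is_derive_pos_sq. }
  assert (Ch := smooth2_continuous2 h Hh).
  assert (CF : continuous2 F) by (apply continuous2_mult; assumption).
  assert (CdF : continuous2 dF).
  { unfold dF. apply continuous2_plus; apply continuous2_mult.
    - apply continuous2_mult; [|exact Cm].
      apply smooth2_continuous2, smooth2_mult; [apply smooth2_const | apply smooth2_fst].
    - exact Ch.
    - exact Cp.
    - apply smooth2_continuous2, smooth2_Derive_fst, Hh. }
  assert (EdF : (fun u v => Derive (fun z => F z v) u) = dF).
  { apply functional_extensionality; intro u; apply functional_extensionality; intro v.
    apply is_derive_unique, HF. }
  assert (HJ : forall x, is_derive (fun x => RInt (F x) (-1) 1) x (RInt (dF x) (-1) 1)).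
  { intros x. rewrite <- EdF. apply (is_derive_RInt_param F (-1) 1 x).
    - apply filter_forall. intros u t _. eexists; apply HF.
    - intros t _. rewrite EdF. apply continuous2_continuity_2d_pt, CdF.
    - apply filter_forall. intros u. apply continuous2_ex_RInt, CF. }
  (* On the sides [x = -1] and [x = 1] of the square [w = - y^2], so [F] vanishes there. *)
  assert (Z : RInt (fun x => RInt (dF x) (-1) 1) (-1) 1 = 0).
  { rewrite (is_RInt_unique _ _ _ _ (is_RInt_derive (fun x => RInt (F x) (-1) 1) _ (-1) 1
      (fun x _ => HJ x) (fun x _ => continuous_RInt_param dF (-1) 1 x ltac:(lra) CdF))).
    assert (F0 : forall x, x ^ 2 = 1 -> RInt (F x) (-1) 1 = 0).
    { intros x Hx. rewrite (RInt_ext _ (fun _ => 0)).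
      - rewrite RInt_const. unfold scal; simpl; unfold mult; simpl; ring.
      - intros y _. unfold F, pos_sq, w. rewrite Rmax_left by nra. change (0 ^ 2 * h x y = 0); ring. }
    rewrite (F0 (-1)), (F0 1) by ring. unfold minus, plus, opp; simpl; ring. }
  rewrite <- Z. unfold disc_int. apply RInt_ext. intros x Hx.
  rewrite Rmin_left, Rmax_right in Hx by lra.
  pose proof (chord_sqr x ltac:(lra)) as Hs. pose proof (chord_pos x). pose proof (chord_le_1 x).
  (* Above and below the chord [w <= 0], so the rest of the square contributes nothing. *)
  assert (Out : forall a b, a <= b -> (forall y, a < y < b -> chord x <= Rabs y) -> RInt (dF x) a b = 0).
  { intros a b Hab Hy. rewrite (RInt_ext _ (fun _ => 0)).
    - rewrite RInt_const. unfold scal; simpl; unfold mult; simpl; ring.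
    - intros y Hy'. rewrite Rmin_left, Rmax_right in Hy' by lra.
      specialize (Hy y Hy'). assert (w x y <= 0).
      { unfold w. rewrite <- (pow2_abs y). nra. }
      unfold dF, pos_sq. rewrite Rmax_left by lra. change (-4 * x * 0 * h x y + 0 ^ 2 * Derive (fun t => h t y) x = 0); ring. }
  rewrite <- (RInt_Chasles (V := R_CompleteNormedModule) (dF x) (-1) (- chord x) 1);
    [|apply continuous2_ex_RInt, CdF|apply continuous2_ex_RInt, CdF].
  rewrite <- (RInt_Chasles (V := R_CompleteNormedModule) (dF x) (- chord x) (chord x) 1);
    [|apply continuous2_ex_RInt, CdF|apply continuous2_ex_RInt, CdF].
  rewrite (Out (-1) (- chord x)); [|lra | intros y Hy; rewrite Rabs_left; lra].
  rewrite (Out (chord x) 1); [|lra | intros y Hy; rewrite Rabs_right; lra].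
  unfold plus; simpl. rewrite Rplus_0_l, Rplus_0_r.
  apply RInt_ext. intros y Hy. rewrite Rmin_left, Rmax_right in Hy by lra.
  assert (Hw : 0 <= w x y) by (unfold w; nra).
  apply is_derive_unique.
  replace (dF x y) with (-4 * x * w x y * h x y + w x y ^ 2 * Derive (fun t => h t y) x)
    by (unfold dF, pos_sq; rewrite (Rmax_right 0 (w x y)) by exact Hw; reflexivity).
  replace (-4 * x * w x y * h x y) with ((-4 * x * w x y) * h x y) by ring.
  apply (is_derive_mult (fun t => w t y ^ 2) (fun t => h t y)).
  - unfold w. auto_derive; [exact I | ring].
  - apply Derive_correct, (proj1 (smooth2_ex_derive h Hh x y)).
  - intros; apply Rmult_comm.
Qed.

(** * Area of the hemisphere *)

(* Area density of the unit sphere in the stereographic chart. *)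
Definition sph_density (x y : R) : R := 4 / (1 + x ^ 2 + y ^ 2) ^ 2.

Create HintDb smooth_base.

Ltac smooth :=
  repeat first
    [ solve [auto with smooth_base nocore]
    | apply smooth2_div | apply smooth2_pow | apply smooth2_mult
    | apply smooth2_minus | apply smooth2_plus | apply smooth2_opp ].

#[local] Hint Resolve smooth2_const smooth2_fst smooth2_snd : smooth_base.

Lemma stereo_den_pos (x y : R) : 0 < 1 + x ^ 2 + y ^ 2.
Proof. nra. Qed.

Lemma sph_density_smooth : smooth2 sph_density.
Proof.
  unfold sph_density. smooth. intros x y. pose proof (stereo_den_pos x y). nra.
Qed.

#[local] Hint Resolve sph_density_smooth : smooth_base.

Lemma RInt_sph_density_chord (t : R) : 0 <= cos t ->
  RInt (sph_density (sin t)) (- cos t) (cos t)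
  = 2 * cos t / (1 + sin t ^ 2)
    + 4 * atan (cos t / sqrt (1 + sin t ^ 2)) / (sqrt (1 + sin t ^ 2) * (1 + sin t ^ 2)).
Proof.
  intros Hc. set (s := sin t). set (c := cos t) in *. set (m := sqrt (1 + s ^ 2)).
  assert (Hs : 0 < 1 + s ^ 2) by nra.
  assert (Hm : 0 < m) by (apply sqrt_lt_R0, Hs).
  assert (Hm2 : m ^ 2 = 1 + s ^ 2) by (apply pow2_sqrt; lra).
  assert (Hsc : s ^ 2 + c ^ 2 = 1).
  { pose proof (sin2_cos2 t) as H. unfold Rsqr in H. unfold s, c. lra. }
  (* The standard primitive of [4 / (m^2 + y^2)^2], with [m^2 = 1 + s^2]. *)
  set (Phi := fun y => 2 * y / ((1 + s ^ 2) * (1 + s ^ 2 + y ^ 2))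
                       + 2 * atan (y / m) / (m * (1 + s ^ 2))).
  assert (HD : is_RInt (sph_density s) (- c) c (minus (Phi c) (Phi (- c)))).
  { apply (is_RInt_derive Phi).
    - intros y _. unfold Phi, sph_density. auto_derive; [nra|].
      assert (0 < 1 + s ^ 2 + y ^ 2) by nra.
      rewrite <- !Hm2. assert (m ^ 2 + y ^ 2 <> 0) by nra. replace (s * (s * 1)) with (m ^ 2 - 1) by (rewrite Hm2; ring).
      field. repeat split; nra.
    - intros y _. apply continuous2_section, smooth2_continuous2, sph_density_smooth. }
  rewrite (is_RInt_unique _ _ _ _ HD).
  unfold minus, plus, opp; simpl. unfold Phi.
  replace (- c / m) with (- (c / m)) by (field; lra). rewrite atan_opp.
  replace (1 + s ^ 2 + c ^ 2) with 2 by lra.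
  replace (1 + s ^ 2 + (- c) ^ 2) with 2 by (replace ((- c) ^ 2) with (c ^ 2) by ring; lra).
  field. repeat split; nra.
Qed.

(* With [x = sin t] the outer integrand has an antiderivative that is smooth up to
   the endpoints. *)
Lemma disc_int_sph_density : disc_int sph_density = 2 * PI.
Proof.
  assert (HPI := PI_RGT_0).
  set (h := fun x => RInt (sph_density x) (- chord x) (chord x)).
  change (RInt h (-1) 1 = 2 * PI).
  assert (Cs := smooth2_continuous2 sph_density sph_density_smooth).
  pose proof (RInt_comp (V := R_CompleteNormedModule) h sin cos (- (PI / 2)) (PI / 2)) as HC.
  rewrite sin_neg, sin_PI2 in HC.
  replace (- (1)) with (-1) in HC by lra. rewrite <- HC; clear HC.
  2: intros; apply continuous_inner, Cs.
  2: { intros x _; split; [apply is_derive_sin | apply continuous_cos]. }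
  (* Integration by parts with [m = sqrt (1 + sin t ^ 2)]: the derivative of [sin t / m] is
     [cos t / m^3], that of [atan (cos t / m)] is [- sin t / m], and the terms left over add up to
     the constant 2. *)
  set (Phi := fun t => 4 * sin t * atan (cos t / sqrt (1 + sin t ^ 2)) / sqrt (1 + sin t ^ 2) + 2 * t).
  apply is_RInt_unique.
  apply (is_RInt_ext (fun t => cos t *
     (2 * cos t / (1 + sin t ^ 2)
    + 4 * atan (cos t / sqrt (1 + sin t ^ 2)) / (sqrt (1 + sin t ^ 2) * (1 + sin t ^ 2))))).
  { intros t Ht. rewrite Rmin_left, Rmax_right in Ht by lra.
    assert (Hc : 0 <= cos t) by (apply cos_ge_0; lra).
    unfold scal; simpl; unfold mult; simpl. unfold h. f_equal.
    replace (chord (sin t)) with (cos t); [symmetry; apply RInt_sph_density_chord, Hc|].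
    unfold chord. pose proof (sin2_cos2 t) as H; unfold Rsqr in H.
    replace (1 - sin t ^ 2) with (cos t ^ 2) by lra. rewrite sqrt_pow2; [reflexivity | exact Hc]. }
  replace (2 * PI) with (minus (Phi (PI / 2)) (Phi (- (PI / 2)))).
  2: { unfold minus, plus, opp; simpl. unfold Phi. rewrite cos_neg, cos_PI2.
       assert (E : forall k, atan (0 / k) = 0) by (intro; unfold Rdiv; rewrite Rmult_0_l; apply atan_0).
       rewrite !E. unfold Rdiv. rewrite !Rmult_0_r, !Rmult_0_l. lra. }
  assert (Hs : forall t, 0 < 1 + sin t ^ 2) by (intros; nra).
  assert (Hm : forall t, 0 < sqrt (1 + sin t ^ 2)) by (intros; apply sqrt_lt_R0, Hs).
  apply (is_RInt_derive Phi).
  - intros t _. unfold Phi. specialize (Hs t). specialize (Hm t).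
    auto_derive; [repeat split; try nra; simpl in *; lra|].
    set (s := sin t) in *. set (c := cos t) in *.
    replace (1 + s * (s * 1)) with (1 + s ^ 2) by ring.
    set (m := sqrt (1 + s ^ 2)) in *.
    assert (Hm2 : m ^ 2 = 1 + s ^ 2) by (apply pow2_sqrt; lra).
    assert (Hsc : s ^ 2 + c ^ 2 = 1).
    { pose proof (sin2_cos2 t) as H. unfold Rsqr in H. unfold s, c. lra. }
    set (T := atan _).
    assert (Hc2 : c ^ 2 = 2 - m ^ 2) by lra. assert (Hs2 : s ^ 2 = m ^ 2 - 1) by lra.
    rewrite <- Hm2.
    transitivity (4 * c * T * (m ^ 2 - s ^ 2) / m ^ 3 + 2 - 4 * s ^ 2 / m ^ 2).
    + assert (m ^ 2 + c ^ 2 <> 0) by nra. field. repeat split; nra.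
    + replace (c * (2 * c / m ^ 2 + 4 * T / (m * m ^ 2)))
        with (2 * c ^ 2 / m ^ 2 + 4 * c * T / m ^ 3) by (field; lra).
      rewrite Hc2, Hs2. field. lra.
  - intros t _. apply (ex_derive_continuous (V := R_NormedModule)).
    specialize (Hs t). specialize (Hm t). auto_derive. repeat split; try nra; simpl in *; try lra; nra.
Qed.

(** * The perturbation of the conformal factor and its flux form *)

Definition den (x y : R) : R := 1 + x ^ 2 + y ^ 2.
(** Coordinates in the frame with first axis [(a, b)], which will be the boundary point whose
    [d]-distance to its antipode is less than [PI]. *)
Definition along (a b x y : R) : R := a * x + b * y.
Definition across (a b x y : R) : R := a * y - b * x.
(* Stereographic coordinates: [(X1, X2, X3)] is the point of the hemisphere
   [X3 >= 0] in the frame [(a, b, 0), (-b, a, 0), (0, 0, 1)]; the gnomonic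
   coordinates are [x = X1 / X3] and [y = X2 / X3]. *)
Definition X1 (a b x y : R) : R := 2 * along a b x y / den x y.
Definition X2 (a b x y : R) : R := 2 * across a b x y / den x y.
Definition X3 (x y : R) : R := (1 - x ^ 2 - y ^ 2) / den x y.
(* On the sphere this is [X3^2 + X2^2 + l X1^2], that is
   [X3^2 (1 + l x^2 + y^2)] in gnomonic coordinates. *)
Definition quad (l x1 : R) : R := 1 - (1 - l) * x1 ^ 2.
(* [(B_yy + K N) / X3^2] for [B = / (1 + l x^2 + y^2)] and [N = 2 l B^2]. *)
Definition phi (l K x1 x2 x3 : R) : R :=
  2 * x3 ^ 2 / quad l x1 ^ 2 * (K * l - 1 + 4 * x2 ^ 2 / quad l x1).

Lemma den_neq_0 (x y : R) : den x y <> 0.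
Proof. unfold den; nra. Qed.

Lemma den_ge_1 (x y : R) : 1 <= den x y.
Proof. unfold den; nra. Qed.

Lemma along_across (a b x y : R) : a ^ 2 + b ^ 2 = 1 ->
  along a b x y ^ 2 + across a b x y ^ 2 = x ^ 2 + y ^ 2.
Proof. intros H. unfold along, across.
  transitivity ((a ^ 2 + b ^ 2) * (x ^ 2 + y ^ 2)); [ring | rewrite H; ring].
Qed.

Lemma sphere_eq (a b x y : R) : a ^ 2 + b ^ 2 = 1 ->
  X1 a b x y ^ 2 + X2 a b x y ^ 2 + X3 x y ^ 2 = 1.
Proof.
  intros H. unfold X1, X2, X3. pose proof (den_neq_0 x y) as Hd.
  transitivity ((4 * (along a b x y ^ 2 + across a b x y ^ 2) + (1 - x ^ 2 - y ^ 2) ^ 2) / den x y ^ 2).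
  - field; exact Hd.
  - rewrite along_across by exact H. unfold den in *. field. exact Hd.
Qed.

Lemma quad_bounds (l x1 : R) : 0 < l <= 1 -> x1 ^ 2 <= 1 -> l <= quad l x1 <= 1.
Proof. intros Hl H. unfold quad. nra. Qed.

Lemma X1_le_1 (a b x y : R) : a ^ 2 + b ^ 2 = 1 -> X1 a b x y ^ 2 <= 1.
Proof. intros H. pose proof (sphere_eq a b x y H). nra. Qed.

Lemma quad_pos (l a b x y : R) : 0 < l <= 1 -> a ^ 2 + b ^ 2 = 1 -> 0 < quad l (X1 a b x y).
Proof. intros Hl H. pose proof (quad_bounds l _ Hl (X1_le_1 a b x y H)). lra. Qed.

Lemma den_smooth : smooth2 den.
Proof. unfold den. smooth. Qed.

Lemma along_smooth (a b : R) : smooth2 (along a b).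
Proof. unfold along. smooth. Qed.

Lemma across_smooth (a b : R) : smooth2 (across a b).
Proof. unfold across. smooth. Qed.

Lemma X1_smooth (a b : R) : smooth2 (X1 a b).
Proof.
  unfold X1. apply smooth2_div; [apply den_neq_0 | | apply den_smooth].
  apply smooth2_mult; [apply smooth2_const | apply along_smooth].
Qed.

Lemma X2_smooth (a b : R) : smooth2 (X2 a b).
Proof.
  unfold X2. apply smooth2_div; [apply den_neq_0 | | apply den_smooth].
  apply smooth2_mult; [apply smooth2_const | apply across_smooth].
Qed.

Lemma X3_smooth : smooth2 X3.
Proof. unfold X3. apply smooth2_div; [apply den_neq_0 | smooth | apply den_smooth]. Qed.

#[local] Hint Resolve den_smooth along_smooth across_smooth X1_smooth X2_smooth X3_smooth : smooth_base.

Lemma quad_smooth (l a b : R) : smooth2 (fun x y => quad l (X1 a b x y)).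
Proof. unfold quad. smooth. Qed.

Lemma phi_smooth (l K a b : R) : 0 < l <= 1 -> a ^ 2 + b ^ 2 = 1 ->
  smooth2 (fun x y => phi l K (X1 a b x y) (X2 a b x y) (X3 x y)).
Proof.
  intros Hl H. unfold phi.
  assert (N : forall x y, quad l (X1 a b x y) <> 0)
    by (intros x y; pose proof (quad_pos l a b x y Hl H); lra).
  apply smooth2_mult.
  - apply smooth2_div; [intros; apply pow_nonzero, N | smooth | apply smooth2_pow, quad_smooth].
  - apply smooth2_plus; [smooth|].
    apply smooth2_div; [exact N | smooth | apply quad_smooth].
Qed.

Definition quad_num (l a b x y : R) : R := den x y ^ 2 - 4 * (1 - l) * along a b x y ^ 2.

Lemma quad_eq (l a b x y : R) : quad l (X1 a b x y) = quad_num l a b x y / den x y ^ 2.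
Proof. unfold quad, X1, quad_num. field. apply den_neq_0. Qed.

Lemma quad_num_pos (l a b x y : R) : 0 < l <= 1 -> a ^ 2 + b ^ 2 = 1 -> 0 < quad_num l a b x y.
Proof.
  intros Hl H. pose proof (quad_pos l a b x y Hl H) as HS. rewrite quad_eq in HS.
  pose proof (den_ge_1 x y) as Hd.
  replace (quad_num l a b x y) with (quad_num l a b x y / den x y ^ 2 * den x y ^ 2) by (field; lra).
  apply Rmult_lt_0_compat; [exact HS | nra].
Qed.

(* Up to the factor [(1 - x^2 - y^2)^2], the field [-2 X2 X3^2 / quad^2 * grad X2],
   which is [B_y w d/dy] in gnomonic coordinates, [w] being the third coordinate. *)
Definition flux1 (l a b x y : R) : R :=
  8 * across a b x y * (b * den x y + 2 * across a b x y * x) / (den x y * quad_num l a b x y ^ 2).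
Definition flux2 (l a b x y : R) : R :=
  8 * across a b x y * (- a * den x y + 2 * across a b x y * y) / (den x y * quad_num l a b x y ^ 2).

Lemma flux_smooth (l a b : R) : 0 < l <= 1 -> a ^ 2 + b ^ 2 = 1 ->
  smooth2 (flux1 l a b) /\ smooth2 (flux2 l a b).
Proof.
  intros Hl H.
  assert (N : forall x y, den x y * quad_num l a b x y ^ 2 <> 0).
  { intros x y. pose proof (quad_num_pos l a b x y Hl H). pose proof (den_neq_0 x y).
    apply Rmult_integral_contrapositive_currified; [assumption | apply pow_nonzero; lra]. }
  split; (apply smooth2_div; [exact N | unfold flux1, flux2; smooth |
   unfold quad_num; smooth]).
Qed.

(** What integration by parts leaves: in gnomonic coordinates, with [w] the third coordinate,
    [B_yy w] turns into [- B_y w_y = - 2 y^2 B^2 w^3], and the [K] term is kept. *)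
Definition rest (l K x1 x2 x3 : R) : R := 2 * x3 ^ 2 / quad l x1 ^ 2 * (K * l - x2 ^ 2).

(** One shape serves both components: [flux1] in the variable [x] with [c = b], and [flux2] in the
    variable [y] with [c = - a]. *)
Lemma is_derive_flux (w D z S : R -> R) (c t w' D' z' S' : R) :
  is_derive w t w' -> is_derive D t D' -> is_derive z t z' -> is_derive S t S' ->
  D t <> 0 -> S t <> 0 ->
  is_derive (fun t => w t ^ 2 * (8 * z t * (c * D t + 2 * z t * t) / (D t * S t ^ 2))) t
    (2 * w t * w' * (8 * z t * (c * D t + 2 * z t * t) / (D t * S t ^ 2))
     + w t ^ 2 * ((8 * z' * (c * D t + 2 * z t * t) + 8 * z t * (c * D' + 2 * z' * t + 2 * z t))
                    / (D t * S t ^ 2)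
        - 8 * z t * (c * D t + 2 * z t * t) * (D' * S t + 2 * D t * S') / (D t ^ 2 * S t ^ 3))).
Proof.
  intros Hw HD Hz HS ND NS.
  auto_derive.
  - repeat split; try (eexists; eassumption).
    apply Rmult_integral_contrapositive_currified; [assumption|].
    apply Rmult_integral_contrapositive_currified; [assumption | rewrite Rmult_1_r; assumption].
  - rewrite (is_derive_unique (fun u : R => w u) _ _ Hw), (is_derive_unique (fun u : R => D u) _ _ HD),
      (is_derive_unique (fun u : R => z u) _ _ Hz), (is_derive_unique (fun u : R => S u) _ _ HS).
    field. split; assumption.
Qed.

(** The stereographic chart is conformal, so the density times the spherical divergence of
    [h grad X2] is the Euclidean divergence of [h] times the chart gradient of [X2]; no metric
    factor enters the flux. *)
Lemma flux_div (l K a b x y : R) : 0 < l <= 1 -> a ^ 2 + b ^ 2 = 1 ->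
  phi l K (X1 a b x y) (X2 a b x y) (X3 x y) * sph_density x y =
  Derive (fun t => (1 - t ^ 2 - y ^ 2) ^ 2 * flux1 l a b t y) x
  + Derive (fun t => (1 - x ^ 2 - t ^ 2) ^ 2 * flux2 l a b x t) y
  + rest l K (X1 a b x y) (X2 a b x y) (X3 x y) * sph_density x y.
Proof.
  intros Hl H. pose proof (quad_num_pos l a b x y Hl H) as HS. pose proof (den_ge_1 x y) as Hd.
  assert (D1 := is_derive_flux (fun t => 1 - t ^ 2 - y ^ 2) (fun t => den t y)
    (fun t => across a b t y) (fun t => quad_num l a b t y) b x (- 2 * x) (2 * x) (- b)
    (4 * x * den x y - 8 * (1 - l) * along a b x y * a)).
  assert (D2 := is_derive_flux (fun t => 1 - x ^ 2 - t ^ 2) (fun t => den x t)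
    (fun t => across a b x t) (fun t => quad_num l a b x t) (- a) y (- 2 * y) (2 * y) a
    (4 * y * den x y - 8 * (1 - l) * along a b x y * b)).
  cbv beta in D1, D2.
  pose proof (is_derive_unique _ _ _ (D1 ltac:(auto_derive; [exact I | ring])
    ltac:(unfold den; auto_derive; [exact I | ring])
    ltac:(unfold across; auto_derive; [exact I | ring])
    ltac:(unfold quad_num, den, along; auto_derive; [exact I | ring])
    ltac:(lra) ltac:(lra))) as E1.
  pose proof (is_derive_unique _ _ _ (D2 ltac:(auto_derive; [exact I | ring])
    ltac:(unfold den; auto_derive; [exact I | ring])
    ltac:(unfold across; auto_derive; [exact I | ring])
    ltac:(unfold quad_num, den, along; auto_derive; [exact I | ring])
    ltac:(lra) ltac:(lra))) as E2.
  match type of E1 with _ = ?r =>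
    replace (Derive (fun t => (1 - t ^ 2 - y ^ 2) ^ 2 * flux1 l a b t y) x) with r
      by (symmetry; exact E1) end.
  match type of E2 with _ = ?r =>
    replace (Derive (fun t => (1 - x ^ 2 - t ^ 2) ^ 2 * flux2 l a b x t) y) with r
      by (symmetry; exact E2) end.
  clear E1 E2.
  clear D1 D2.
  unfold phi, rest. rewrite quad_eq. unfold X2, X3, sph_density.
  change (1 + x ^ 2 + y ^ 2) with (den x y).
  set (w := 1 - x ^ 2 - y ^ 2).
  assert (Hw : w = 2 - den x y) by (unfold w, den; ring).
  assert (F4 : 4 * (1 - l) * along a b x y ^ 2 = den x y ^ 2 - quad_num l a b x y)
    by (unfold quad_num; ring).
  set (S := quad_num l a b x y) in *.
  set (z := across a b x y). set (xi := along a b x y) in *.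
  assert (F0 : a * y - b * x = z) by reflexivity.
  assert (F0' : a * x + b * y = xi) by reflexivity.
  assert (Hr : x ^ 2 + y ^ 2 = den x y - 1) by (unfold den; ring).
  set (D := den x y) in *. clearbody S z xi D w.
  (* [P] and [Q] are the numerators of the two fluxes, [Px] and [Qy] their derivatives in [x] and
     [y]. The divergence involves only the combinations in [F1], [F2], [F3], which depend on [D],
     [z], [xi] alone; this keeps the final rational identity small. *)
  set (P := 8 * z * (b * D + 2 * z * x)). set (Q := 8 * z * (- a * D + 2 * z * y)).
  set (Px := 8 * (- b) * (b * D + 2 * z * x) + 8 * z * (b * (2 * x) + 2 * (- b) * x + 2 * z)).
  set (Qy := 8 * a * (- a * D + 2 * z * y) + 8 * z * (- a * (2 * y) + 2 * a * y + 2 * z)).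
  assert (F1 : x * P + y * Q = 8 * z ^ 2 * (D - 2)).
  { transitivity (8 * z * (- D * (a * y - b * x) + 2 * z * (x ^ 2 + y ^ 2))); [unfold P, Q; ring|].
    rewrite F0, Hr. ring. }
  assert (F2 : Px + Qy = - 8 * D + 48 * z ^ 2).
  { transitivity (- 8 * D * (a ^ 2 + b ^ 2) + 16 * z * (a * y - b * x) + 32 * z ^ 2);
      [unfold Px, Qy; ring|]. rewrite H, F0. ring. }
  assert (F3 : a * P + b * Q = 16 * z ^ 2 * xi).
  { rewrite <- F0'. unfold P, Q. ring. }
  clearbody P Q Px Qy.
  transitivity (2 * (w / D) ^ 2 / (S / D ^ 2) ^ 2 * (K * l - (2 * z / D) ^ 2) * (4 / D ^ 2)
    + 8 * w ^ 2 / S ^ 2 * (-1 + 16 * z ^ 2 / S + 4 * z ^ 2 / D ^ 2)).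
  - field. lra.
  - rewrite Rplus_comm. f_equal.
    transitivity (- 4 * w * (x * P + y * Q) / (D * S ^ 2)
      + w ^ 2 * ((Px + Qy) / (D * S ^ 2)
        - (2 * S * (x * P + y * Q) + 8 * D ^ 2 * (x * P + y * Q)
           - 16 * D * (1 - l) * xi * (a * P + b * Q)) / (D ^ 2 * S ^ 3))).
    + rewrite F1, F2, F3.
      replace (16 * D * (1 - l) * xi * (16 * z ^ 2 * xi))
        with (64 * D * z ^ 2 * (4 * (1 - l) * xi ^ 2)) by ring.
      rewrite F4, Hw. field. lra.
    + field. lra.
Qed.

(** * Negativity of the mean of [phi] for small [l] *)

Lemma quot_smooth (l a b : R) (f : R -> R -> R) : 0 < l <= 1 -> a ^ 2 + b ^ 2 = 1 ->
  smooth2 f -> smooth2 (fun x y => f x y / quad l (X1 a b x y) ^ 2).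
Proof.
  intros Hl H Hf. apply smooth2_div; [|exact Hf | apply smooth2_pow, quad_smooth].
  intros x y. pose proof (quad_pos l a b x y Hl H). apply pow_nonzero; lra.
Qed.

(** The weight [(1 - x^2 - y^2)^2] makes both divergence terms integrate to zero. Of the two
    integrals left, the first tends to 0 with [l], the second stays bounded below. *)
Lemma disc_int_phi (l K a b : R) : 0 < l <= 1 -> a ^ 2 + b ^ 2 = 1 ->
  disc_int (fun x y => phi l K (X1 a b x y) (X2 a b x y) (X3 x y) * sph_density x y) =
  2 * (K * disc_int (fun x y => l * (X3 x y ^ 2 / quad l (X1 a b x y) ^ 2 * sph_density x y))
       - disc_int (fun x y => X3 x y ^ 2 * X2 a b x y ^ 2 / quad l (X1 a b x y) ^ 2 * sph_density x y)).
Proof.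
  intros Hl H. destruct (flux_smooth l a b Hl H) as [G1 G2].
  assert (W1 : smooth2 (fun x y => (1 - x ^ 2 - y ^ 2) ^ 2 * flux1 l a b x y))
    by (apply smooth2_mult; [smooth | exact G1]).
  assert (W2 : smooth2 (fun x y => (1 - x ^ 2 - y ^ 2) ^ 2 * flux2 l a b x y))
    by (apply smooth2_mult; [smooth | exact G2]).
  set (A := fun x y => l * (X3 x y ^ 2 / quad l (X1 a b x y) ^ 2 * sph_density x y)).
  set (B := fun x y => X3 x y ^ 2 * X2 a b x y ^ 2 / quad l (X1 a b x y) ^ 2 * sph_density x y).
  assert (CA : continuous2 A).
  { apply smooth2_continuous2. unfold A. apply smooth2_mult; [apply smooth2_const|].
    apply smooth2_mult; [apply quot_smooth; try assumption; smooth | apply sph_density_smooth]. }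
  assert (CB : continuous2 B).
  { apply smooth2_continuous2. unfold B.
    apply smooth2_mult; [apply quot_smooth; try assumption; smooth | apply sph_density_smooth]. }
  rewrite (disc_int_ext _ (fun x y =>
    (Derive (fun t => (1 - t ^ 2 - y ^ 2) ^ 2 * flux1 l a b t y) x
     + Derive (fun t => (1 - x ^ 2 - t ^ 2) ^ 2 * flux2 l a b x t) y)
    + (2 * K * A x y + (-2) * B x y))).
  2: { intros x y _. rewrite flux_div by assumption. f_equal. unfold rest, A, B.
       pose proof (quad_pos l a b x y Hl H). field. lra. }
  assert (D1 := smooth2_continuous2 _ (smooth2_Derive_fst _ W1)).
  assert (D2 := smooth2_continuous2 _ (smooth2_Derive_snd _ W2)).
  assert (S : forall c f, continuous2 f -> continuous2 (fun x y => c * f x y)).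
  { intros c f Hf. apply continuous2_mult; [|exact Hf].
    apply smooth2_continuous2, smooth2_const. }
  assert (N1 := disc_int_Derive_fst _ G1).
  assert (N2 := disc_int_Derive_snd _ W2).
  rewrite (disc_int_plus (fun x y =>
    Derive (fun t => (1 - t ^ 2 - y ^ 2) ^ 2 * flux1 l a b t y) x
     + Derive (fun t => (1 - x ^ 2 - t ^ 2) ^ 2 * flux2 l a b x t) y)
    (fun x y => 2 * K * A x y + (-2) * B x y)).
  - rewrite (disc_int_plus (fun x y =>
      Derive (fun t => (1 - t ^ 2 - y ^ 2) ^ 2 * flux1 l a b t y) x)
      (fun x y => Derive (fun t => (1 - x ^ 2 - t ^ 2) ^ 2 * flux2 l a b x t) y) D1 D2).
    rewrite N1. cbv beta in N2. rewrite N2.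
    + rewrite (disc_int_plus (fun x y => 2 * K * A x y) (fun x y => (-2) * B x y)) by (apply S; assumption).
      rewrite !disc_int_scal by assumption. ring.
    + intros x y Hxy. replace (1 - x ^ 2 - y ^ 2) with 0 by lra. ring.
  - apply continuous2_plus; assumption.
  - apply continuous2_plus; apply S; assumption.
Qed.

(** Replaces a quartic kernel by a Cauchy kernel of the same width [k], whose primitive is an
    arctangent. *)
Lemma quartic_le (k u : R) : 0 < k -> k ^ 4 / (k ^ 4 + u ^ 4 / 8) <= 8 * (k ^ 2 / (k ^ 2 + u ^ 2)).
Proof.
  intros Hk.
  assert (0 < k ^ 2) by nra. assert (0 <= u ^ 2) by nra.
  replace (k ^ 4) with (k ^ 2 * k ^ 2) by ring. replace (u ^ 4) with (u ^ 2 * u ^ 2) by ring.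
  set (p := k ^ 2) in *. set (q := u ^ 2) in *. clearbody p q.
  apply Rle_div_l; [nra|].
  replace (8 * (p / (p + q)) * (p * p + q * q / 8)) with
    (p * ((8 * p * p + q * q) / (p + q))) by (field; nra).
  apply Rmult_le_compat_l; [lra|]. apply Rle_div_r; nra.
Qed.

(** In the chart [den - 2 along] and [den + 2 along] are the squared distances to [(a, b)] and
    [(- a, - b)], and their product over [den^2] is [1 - X1^2]. Dropping the [y] part of the
    distances leaves a bound in [x] only, of fourth order in the displacement; this is why [l] is
    taken to be [k^4]. *)
Lemma stereo_gap (k a b x y : R) : 0 < k -> k ^ 4 <= 1 / 2 -> a ^ 2 + b ^ 2 = 1 ->
  x ^ 2 + y ^ 2 <= 1 ->
  k ^ 4 / quad (k ^ 4) (X1 a b x y) <= 8 * (k ^ 2 / (k ^ 2 + (x - a) ^ 2))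
                                     + 8 * (k ^ 2 / (k ^ 2 + (x + a) ^ 2)).
Proof.
  intros Hk Hk4 H Hxy.
  assert (Hp : 0 < k ^ 4) by (apply pow_lt; exact Hk).
  pose proof (den_ge_1 x y) as Hd.
  assert (Hd2 : den x y <= 2) by (unfold den; lra).
  set (m := Rmin ((x - a) ^ 2) ((x + a) ^ 2)).
  assert (Hm : 0 <= m) by (apply Rmin_glb; apply pow2_ge_0).
  assert (Hm1 : m <= (x - a) ^ 2) by apply Rmin_l.
  assert (Hm2 : m <= (x + a) ^ 2) by apply Rmin_r.
  assert (Em : m = (x - a) ^ 2 \/ m = (x + a) ^ 2)
    by (unfold m, Rmin; destruct (Rle_dec _ _); auto).
  clearbody m. pose proof (pow2_ge_0 (y - b)). pose proof (pow2_ge_0 (y + b)).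
  assert (E1 : (x - a) ^ 2 <= den x y - 2 * along a b x y).
  { replace (den x y - 2 * along a b x y) with ((x - a) ^ 2 + (y - b) ^ 2 + (1 - (a ^ 2 + b ^ 2)))
      by (unfold den, along; ring). rewrite H. lra. }
  assert (E2 : (x + a) ^ 2 <= den x y + 2 * along a b x y).
  { replace (den x y + 2 * along a b x y) with ((x + a) ^ 2 + (y + b) ^ 2 + (1 - (a ^ 2 + b ^ 2)))
      by (unfold den, along; ring). rewrite H. lra. }
  assert (E3 : m * m / 4 <= 1 - X1 a b x y ^ 2).
  { replace (1 - X1 a b x y ^ 2) with
      ((den x y - 2 * along a b x y) * (den x y + 2 * along a b x y) / den x y ^ 2)
      by (unfold X1; field; lra).
    apply (Rle_div_r (m * m / 4)); [nra|].
    apply Rle_trans with (m * m); [|apply Rmult_le_compat; lra].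
    replace (m * m) with (m * m / 4 * 4) at 2 by field.
    apply Rmult_le_compat_l; [nra|].
    replace 4 with (2 ^ 2) by ring. apply pow_incr; lra. }
  (* With [l = k^4], [quad] is [l + (1 - l) (1 - X1^2)], and [1 - l >= 1/2]. *)
  assert (E4 : k ^ 4 + m * m / 8 <= quad (k ^ 4) (X1 a b x y)) by (unfold quad; nra).
  apply Rle_trans with (k ^ 4 / (k ^ 4 + m * m / 8)).
  { apply Rmult_le_compat_l; [lra|]. apply Rinv_le_contravar; nra. }
  assert (Q : forall u, m = u ^ 2 -> k ^ 4 / (k ^ 4 + m * m / 8) <= 8 * (k ^ 2 / (k ^ 2 + u ^ 2))).
  { intros u ->. replace (u ^ 2 * u ^ 2) with (u ^ 4) by ring. apply quartic_le, Hk. }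
  assert (Pos : forall u, 0 <= k ^ 2 / (k ^ 2 + u ^ 2)).
  { intros u. apply Rlt_le, Rdiv_lt_0_compat; nra. }
  pose proof (Pos (x - a)). pose proof (Pos (x + a)).
  destruct Em as [Em|Em]; specialize (Q _ Em); lra.
Qed.

Lemma cauchy_continuous (k c x : R) : 0 < k -> continuous (fun x => k ^ 2 / (k ^ 2 + (x + c) ^ 2)) x.
Proof.
  intros Hk. apply (ex_derive_continuous (V := R_NormedModule)). auto_derive. pose proof (pow2_ge_0 (x + c)). pose proof (pow_lt k 2 Hk). simpl in *. lra.
Qed.

Lemma RInt_cauchy_le (k c : R) : 0 < k ->
  RInt (fun x => k ^ 2 / (k ^ 2 + (x + c) ^ 2)) (-1) 1 <= k * PI.
Proof.
  intros Hk.
  assert (HD : is_RInt (fun x => k ^ 2 / (k ^ 2 + (x + c) ^ 2)) (-1) 1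
    (minus ((fun x => k * atan ((x + c) / k)) 1) ((fun x => k * atan ((x + c) / k)) (-1)))).
  { apply (is_RInt_derive (fun x => k * atan ((x + c) / k))).
    - intros x _. auto_derive; [lra|]. field. pose proof (pow2_ge_0 (x + c)). pose proof (pow_lt k 2 Hk). split; [nra|]. lra.
    - intros x _. apply cauchy_continuous, Hk. }
  rewrite (is_RInt_unique _ _ _ _ HD). unfold minus, plus, opp; simpl.
  pose proof (atan_bound ((1 + c) / k)). pose proof (atan_bound ((-1 + c) / k)).
  nra.
Qed.

(** Since [quad = X3^2 + X2^2 + l X1^2], one factor [X3^2 / quad] is at most 1, and [l / quad]
    concentrates at the two ends of the axis. The constant is [2 * (32 + 32)]: 2 for the chord
    length, and 32 for each end, from the density bound 4 times the 8 of [stereo_gap]. *)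
Lemma disc_int_rest_le (k a b : R) : 0 < k -> k ^ 4 <= 1 / 2 -> a ^ 2 + b ^ 2 = 1 ->
  disc_int (fun x y => k ^ 4 * (X3 x y ^ 2 / quad (k ^ 4) (X1 a b x y) ^ 2 * sph_density x y))
  <= 128 * (k * PI).
Proof.
  intros Hk Hk4 H.
  assert (Hp : 0 < k ^ 4) by (apply pow_lt; exact Hk).
  assert (Hl : 0 < k ^ 4 <= 1) by lra.
  set (g := fun x => 32 * (k ^ 2 / (k ^ 2 + (x + - a) ^ 2)) + 32 * (k ^ 2 / (k ^ 2 + (x + a) ^ 2))).
  assert (Cg : forall x, continuous g x).
  { intros x. apply (continuous_plus (V := R_NormedModule));
     (apply (continuous_mult (K := R_AbsRing)); [apply continuous_const | apply cauchy_continuous, Hk]). }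
  assert (Pos : forall u, 0 <= k ^ 2 / (k ^ 2 + u ^ 2)).
  { intros u. apply Rlt_le, Rdiv_lt_0_compat; nra. }
  apply Rle_trans with (2 * RInt g (-1) 1).
  - apply disc_int_le_fst.
    + apply smooth2_continuous2. apply smooth2_mult; [apply smooth2_const|].
      apply smooth2_mult; [apply quot_smooth; try assumption; smooth | apply sph_density_smooth].
    + exact Cg.
    + intros x. unfold g. pose proof (Pos (x + - a)). pose proof (Pos (x + a)). lra.
    + intros x y Hxy. pose proof (stereo_gap k a b x y Hk Hk4 H Hxy) as G.
      pose proof (quad_pos (k ^ 4) a b x y Hl H) as HS.
      pose proof (sphere_eq a b x y H) as HE.
      assert (Hz : X3 x y ^ 2 <= quad (k ^ 4) (X1 a b x y)) by (unfold quad; nra).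
      set (S := quad (k ^ 4) (X1 a b x y)) in *.
      assert (Hs : 0 < sph_density x y <= 4).
      { unfold sph_density. change (1 + x ^ 2 + y ^ 2) with (den x y). pose proof (den_ge_1 x y).
        split; [apply Rdiv_lt_0_compat; nra | apply Rle_div_l; nra]. }
      apply Rle_trans with (k ^ 4 / S * 4).
      * replace (k ^ 4 * (X3 x y ^ 2 / S ^ 2 * sph_density x y))
          with (k ^ 4 / S * (X3 x y ^ 2 / S * sph_density x y)) by (field; lra).
        apply Rmult_le_compat_l; [apply Rlt_le, Rdiv_lt_0_compat; lra|].
        assert (X3 x y ^ 2 / S <= 1) by (apply Rle_div_l; lra).
        assert (0 <= X3 x y ^ 2 / S) by (apply Rmult_le_pos; [nra | apply Rlt_le, Rinv_0_lt_compat; lra]).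
        nra.
      * unfold g, Rminus in *. lra.
  - unfold g.
    assert (Ex : forall c, ex_RInt (fun x => k ^ 2 / (k ^ 2 + (x + c) ^ 2)) (-1) 1).
    { intros c. apply (ex_RInt_continuous (V := R_CompleteNormedModule)); intros; apply cauchy_continuous, Hk. }
    assert (E : RInt g (-1) 1 = 32 * RInt (fun x => k ^ 2 / (k ^ 2 + (x + - a) ^ 2)) (-1) 1
      + 32 * RInt (fun x => k ^ 2 / (k ^ 2 + (x + a) ^ 2)) (-1) 1).
    { apply is_RInt_unique. apply (is_RInt_plus (V := R_NormedModule));
       apply (is_RInt_scal (V := R_NormedModule)), (RInt_correct (V := R_CompleteNormedModule)), Ex. }
    fold g. rewrite E.
    pose proof (RInt_cauchy_le k (- a) Hk). pose proof (RInt_cauchy_le k a Hk). lra.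
Qed.

Lemma phi_integral_neg (K a b : R) : 0 < K -> a ^ 2 + b ^ 2 = 1 ->
  exists l, 0 < l <= 1 /\
    disc_int (fun x y => phi l K (X1 a b x y) (X2 a b x y) (X3 x y) * sph_density x y) < 0.
Proof.
  intros HK H. pose proof PI_RGT_0 as HPI.
  set (f := fun x y => X3 x y ^ 2 * X2 a b x y ^ 2 * sph_density x y).
  assert (Cf : continuous2 f) by (apply smooth2_continuous2; unfold f; smooth).
  assert (Hs : forall x y, 0 < sph_density x y).
  { intros x y. unfold sph_density. apply Rdiv_lt_0_compat; [lra|]. apply pow_lt, stereo_den_pos. }
  assert (Pf : 0 < disc_int f).
  { apply (disc_int_pos_at f (- b / 2) (a / 2) Cf).
    - intros x y _. unfold f. pose proof (Hs x y). apply Rmult_le_pos; [|lra]. nra.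
    - nra.
    - unfold f. apply Rmult_lt_0_compat; [|apply Hs].
      assert (E : (- b / 2) ^ 2 + (a / 2) ^ 2 = 1 / 4) by (transitivity ((a ^ 2 + b ^ 2) / 4); [field | rewrite H; lra]).
      unfold X3, X2, across, den.
      replace (1 - (- b / 2) ^ 2 - (a / 2) ^ 2) with (3 / 4) by lra.
      replace (1 + (- b / 2) ^ 2 + (a / 2) ^ 2) with (5 / 4) by lra.
      replace (a * (a / 2) - b * (- b / 2)) with (1 / 2) by (transitivity ((a ^ 2 + b ^ 2) / 2); [rewrite H; lra | field]).
      lra. }
  (* With this [k], [K] times the bound [128 k PI] is at most half of [disc_int f]. *)
  set (k := Rmin (1 / 2) (disc_int f / (256 * PI * K))).
  assert (Hk : 0 < k).
  { apply Rmin_glb_lt; [lra|]. apply Rdiv_lt_0_compat; [exact Pf|].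
    apply Rmult_lt_0_compat; lra. }
  assert (Hk1 : k <= 1 / 2) by apply Rmin_l.
  assert (Hk2 : k <= disc_int f / (256 * PI * K)) by apply Rmin_r.
  assert (Hk4 : k ^ 4 <= 1 / 2).
  { assert (k ^ 2 <= 1 / 4) by nra. replace (k ^ 4) with (k ^ 2 * k ^ 2) by ring. nra. }
  assert (Hl : 0 < k ^ 4 <= 1) by (split; [apply pow_lt; exact Hk | lra]).
  exists (k ^ 4). split; [exact Hl|].
  rewrite (disc_int_phi (k ^ 4) K a b Hl H).
  pose proof (disc_int_rest_le k a b Hk Hk4 H) as B1.
  assert (B2 : disc_int f <= disc_int (fun x y =>
     X3 x y ^ 2 * X2 a b x y ^ 2 / quad (k ^ 4) (X1 a b x y) ^ 2 * sph_density x y)).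
  { apply disc_int_le; [exact Cf | |].
    - apply smooth2_continuous2.
      apply smooth2_mult; [apply quot_smooth; try assumption; smooth | apply sph_density_smooth].
    - intros x y _. unfold f. apply Rmult_le_compat_r; [apply Rlt_le, Hs|].
      pose proof (quad_bounds (k ^ 4) _ Hl (X1_le_1 a b x y H)) as HS.
      set (q := X3 x y ^ 2 * X2 a b x y ^ 2).
      apply (Rle_div_r q); [nra|]. assert (0 <= q) by (unfold q; nra).
      assert (quad (k ^ 4) (X1 a b x y) ^ 2 <= 1) by nra. nra. }
  apply Rle_div_r in Hk2; [|apply Rmult_lt_0_compat; lra].
  set (I1 := disc_int (fun x y => k ^ 4 * _)) in *.
  assert (K * I1 <= K * (128 * (k * PI))) by (apply Rmult_le_compat_l; lra).
  lra.
Qed.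

(** * Lower bounds for the length of curves *)

Definition conformal (h : R -> R -> R) : metric_tensor := MkTensor h (fun _ _ => 0) h.

(** The arclength up to [t] plus [G t] has nonnegative derivative. The mean value theorem is applied
    to this sum, so the pointwise bound on [G'] is all that enters. *)
Lemma curve_length_ge (h : R -> R -> R) (c1 c2 G G' : R -> R) :
  continuous2 h -> C1_curve c1 c2 ->
  (forall t, 0 <= t <= 1 -> is_derive G t (G' t)) ->
  (forall t, 0 <= t <= 1 ->
     G' t ^ 2 <= h (c1 t) (c2 t) * (Derive c1 t ^ 2 + Derive c2 t ^ 2)) ->
  G 0 - G 1 <= curve_length (conformal h) c1 c2.
Proof.
  intros Ch [Hd Hc] HG Hb. unfold curve_length, conformal; simpl gE; simpl gF; simpl gG.
  set (f := fun t => sqrt (h (c1 t) (c2 t) * Derive c1 t ^ 2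
     + 2 * 0 * Derive c1 t * Derive c2 t + h (c1 t) (c2 t) * Derive c2 t ^ 2)).
  change (G 0 - G 1 <= RInt f 0 1).
  assert (Cf : forall t, continuous f t).
  { intros t. unfold f. apply continuous_sqrt_comp.
    assert (Cht : continuous (fun t => h (c1 t) (c2 t)) t).
    { apply (continuous_comp_2 c1 c2 h); [| | apply Ch];
      apply (ex_derive_continuous (V := R_NormedModule)), Hd. }
    assert (Csq : forall k : R -> R, continuous k t -> continuous (fun t => k t ^ 2) t).
    { intros k Hk. apply (continuous_ext (fun t => k t * k t)); [intros s; change (k s * k s = k s ^ 2); ring|].
      apply (continuous_mult (K := R_AbsRing)); exact Hk. }
    destruct (Hc t) as [H1 H2].
    assert (Cm : forall k1 k2 : R -> R, continuous k1 t -> continuous k2 t ->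
      continuous (fun t => k1 t * k2 t) t) by (intros; apply (continuous_mult (K := R_AbsRing)); assumption).
    apply (continuous_plus (V := R_NormedModule)); [apply (continuous_plus (V := R_NormedModule))|].
    - apply (Cm (fun t => h (c1 t) (c2 t)) (fun t => Derive c1 t ^ 2)); [exact Cht | apply Csq, H1].
    - apply (Cm (fun t => 2 * 0 * Derive c1 t) (Derive c2)); [|exact H2].
      apply (Cm (fun _ => 2 * 0) (Derive c1)); [apply continuous_const | exact H1].
    - apply (Cm (fun t => h (c1 t) (c2 t)) (fun t => Derive c2 t ^ 2)); [exact Cht | apply Csq, H2]. }
  assert (HI : forall t, is_derive (fun t => RInt f 0 t) t (f t)).
  { intros t. apply (is_derive_RInt f _ 0 t); [|apply Cf].
    apply filter_forall. intros u. apply (RInt_correct (V := R_CompleteNormedModule)).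
    apply (ex_RInt_continuous (V := R_CompleteNormedModule)); intros; apply Cf. }
  assert (HS : forall t, 0 <= t <= 1 -> is_derive (fun t => RInt f 0 t + G t) t (f t + G' t)).
  { intros t Ht. apply (is_derive_plus (V := R_NormedModule)); [apply HI | apply HG, Ht]. }
  destruct (MVT_gen (fun t => RInt f 0 t + G t) 0 1 (fun t => f t + G' t)) as [t [Ht E]].
  - intros t Ht. rewrite Rmin_left, Rmax_right in Ht by lra. apply HS; lra.
  - intros t Ht. rewrite Rmin_left, Rmax_right in Ht by lra.
    apply continuity_pt_filterlim.
    apply (ex_derive_continuous (V := R_NormedModule) (fun t => RInt f 0 t + G t)).
    eexists; apply HS; lra.
  - rewrite Rmin_left, Rmax_right in Ht by lra.
    cbv beta in E. rewrite RInt_point in E. unfold zero in E; simpl in E.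
    assert (Rabs (G' t) <= f t).
    { unfold f. rewrite <- sqrt_Rsqr_abs. apply sqrt_le_1_alt. unfold Rsqr.
      pose proof (Hb t Ht). lra. }
    pose proof (Rle_abs (- G' t)) as HA. rewrite Rabs_Ropp in HA. lra.
Qed.

(** * The arcsine up to the ends of its domain *)

Lemma is_derive_asin (x : R) : -1 < x < 1 -> is_derive asin x (/ sqrt (1 - x ^ 2)).
Proof.
  intros Hx. apply is_derive_Reals.
  pose proof (derive_pt_asin x Hx) as H.
  replace (/ sqrt (1 - x ^ 2)) with (derive_pt asin x (derivable_pt_asin x Hx)).
  - apply derive_pt_eq_1 with (derivable_pt_asin x Hx). reflexivity.
  - rewrite H. unfold Rsqr. replace (x ^ 2) with (x * x) by ring. unfold Rdiv; ring.
Qed.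

(* [cos e * u >= sin (asin u - e)] because [cos (asin u) >= 0]. *)
Lemma asin_scale (u e : R) : -1 <= u <= 1 -> 0 < e < PI / 2 ->
  asin u - e <= asin (cos e * u) <= asin u + e.
Proof.
  intros Hu He. pose proof PI_RGT_0.
  pose proof (asin_bound u) as Hb.
  assert (Hc : 0 < cos e) by (apply cos_gt_0; lra).
  assert (Hc1 : cos e <= 1) by (apply COS_bound).
  assert (Hs : 0 < sin e) by (apply sin_gt_0; lra).
  assert (Hcu : -1 <= cos e * u <= 1) by nra.
  assert (Hca : 0 <= cos (asin u)) by (apply cos_ge_0; lra).
  pose proof (asin_bound (cos e * u)) as Hb2.
  split.
  - destruct (Rle_dec (asin u - e) (- (PI / 2))); [lra|].
    apply sin_incr_0; try lra.
    rewrite sin_minus, !sin_asin by lra. nra.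
  - destruct (Rle_dec (PI / 2) (asin u + e)); [lra|].
    apply sin_incr_0; try lra.
    rewrite sin_plus, !sin_asin by lra. nra.
Qed.

(** A calibration by [asin u] is singular where [u] is 1 or -1, and curves may start or pass there.
    Estimates are therefore made for [asin (q u)] with [q < 1]; by [asin_scale] the limit is uniform
    in [u]. *)
Lemma asin_diff_limit (m u v L : R) : 0 <= m -> -1 <= u <= 1 -> -1 <= v <= 1 ->
  (forall q, 0 < q < 1 -> m * (asin (q * u) - asin (q * v)) <= L) ->
  m * (asin u - asin v) <= L.
Proof.
  intros Hm Hu Hv H. apply le_epsilon. intros e He.
  pose proof PI_RGT_0.
  (* Each of the two arcsines moves by at most [e'], and [2 m e' <= e]. *)
  set (e' := Rmin 1 (e / (2 * m + 1))).
  assert (H1 : 0 < e') by (apply Rmin_glb_lt; [lra | apply Rdiv_lt_0_compat; lra]).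
  assert (H2 : e' <= 1) by apply Rmin_l.
  assert (H3 : e' <= e / (2 * m + 1)) by apply Rmin_r.
  apply (Rle_div_r e') in H3; [|lra].
  pose proof PI2_1.
  assert (Hq : 0 < cos e' < 1).
  { split; [apply cos_gt_0; lra|]. rewrite <- cos_0. apply cos_decreasing_1; lra. }
  specialize (H _ Hq).
  pose proof (asin_scale u e' Hu ltac:(lra)). pose proof (asin_scale v e' Hv ltac:(lra)).
  nra.
Qed.

(** * Spherical components of a velocity given in the chart *)

Definition dX1 (a b x y v w : R) : R :=
  (2 * along a b v w * den x y - 2 * along a b x y * (2 * x * v + 2 * y * w)) / den x y ^ 2.
Definition dX2 (a b x y v w : R) : R :=
  (2 * across a b v w * den x y - 2 * across a b x y * (2 * x * v + 2 * y * w)) / den x y ^ 2.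
Definition dX3 (x y v w : R) : R := - 2 * (2 * x * v + 2 * y * w) / den x y ^ 2.

Lemma is_derive_X (a b : R) (c1 c2 : R -> R) (t : R) : ex_derive c1 t -> ex_derive c2 t ->
  is_derive (fun t => X1 a b (c1 t) (c2 t)) t (dX1 a b (c1 t) (c2 t) (Derive c1 t) (Derive c2 t)) /\
  is_derive (fun t => X2 a b (c1 t) (c2 t)) t (dX2 a b (c1 t) (c2 t) (Derive c1 t) (Derive c2 t)) /\
  is_derive (fun t => X3 (c1 t) (c2 t)) t (dX3 (c1 t) (c2 t) (Derive c1 t) (Derive c2 t)).
Proof.
  intros H1 H2. pose proof (den_neq_0 (c1 t) (c2 t)) as Hd.
  unfold X1, X2, X3, dX1, dX2, dX3, along, across, den in *.
  split; [|split]; (auto_derive; [repeat split; try assumption; simpl in Hd; exact Hd|]);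
    change (Derive (fun x => c1 x) t) with (Derive c1 t);
    change (Derive (fun x => c2 x) t) with (Derive c2 t); field; exact Hd.
Qed.

Lemma velocity_tangent (a b x y v w : R) : a ^ 2 + b ^ 2 = 1 ->
  X1 a b x y * dX1 a b x y v w + X2 a b x y * dX2 a b x y v w + X3 x y * dX3 x y v w = 0.
Proof.
  intros H. pose proof (den_neq_0 x y) as Hd.
  assert (F1 := along_across a b x y H).
  assert (F2 : along a b x y * along a b v w + across a b x y * across a b v w = x * v + y * w).
  { unfold along, across. transitivity ((a ^ 2 + b ^ 2) * (x * v + y * w)); [ring | rewrite H; ring]. }
  assert (F3 : x ^ 2 + y ^ 2 = den x y - 1) by (unfold den; ring).
  assert (F4 : 1 - x ^ 2 - y ^ 2 = 2 - den x y) by (unfold den; ring).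
  unfold X1, X2, X3, dX1, dX2, dX3. rewrite F4. rewrite F3 in F1.
  transitivity ((4 * den x y * (along a b x y * along a b v w + across a b x y * across a b v w)
    - 8 * (along a b x y ^ 2 + across a b x y ^ 2) * (x * v + y * w)
    - 4 * (2 - den x y) * (x * v + y * w)) / den x y ^ 3).
  - field. exact Hd.
  - rewrite F1, F2. field. exact Hd.
Qed.

(** Conformality of stereographic projection, with factor [sph_density]. *)
Lemma velocity_norm (a b x y v w : R) : a ^ 2 + b ^ 2 = 1 ->
  dX1 a b x y v w ^ 2 + dX2 a b x y v w ^ 2 + dX3 x y v w ^ 2 = sph_density x y * (v ^ 2 + w ^ 2).
Proof.
  intros H. pose proof (den_neq_0 x y) as Hd.
  assert (F1 := along_across a b x y H). assert (F0 := along_across a b v w H).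
  assert (F2 : along a b x y * along a b v w + across a b x y * across a b v w = x * v + y * w).
  { unfold along, across. transitivity ((a ^ 2 + b ^ 2) * (x * v + y * w)); [ring | rewrite H; ring]. }
  assert (F3 : x ^ 2 + y ^ 2 = den x y - 1) by (unfold den; ring).
  unfold dX1, dX2, dX3, sph_density. change (1 + x ^ 2 + y ^ 2) with (den x y). rewrite F3 in F1.
  transitivity ((4 * den x y ^ 2 * (along a b v w ^ 2 + across a b v w ^ 2)
    - 16 * den x y * (x * v + y * w)
       * (along a b x y * along a b v w + across a b x y * across a b v w)
    + 16 * (along a b x y ^ 2 + across a b x y ^ 2) * (x * v + y * w) ^ 2
    + 16 * (x * v + y * w) ^ 2) / den x y ^ 4).
  - field. exact Hd.
  - rewrite F0, F1, F2. field. exact Hd.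
Qed.

(* Lagrange's identity for [V] and [W - (W . P) P]. *)
Lemma tangent_cauchy_schwarz (p1 p2 p3 v1 v2 v3 w1 w2 w3 : R) :
  p1 ^ 2 + p2 ^ 2 + p3 ^ 2 = 1 -> p1 * v1 + p2 * v2 + p3 * v3 = 0 ->
  (w1 * v1 + w2 * v2 + w3 * v3) ^ 2 <=
  (w1 ^ 2 + w2 ^ 2 + w3 ^ 2 - (w1 * p1 + w2 * p2 + w3 * p3) ^ 2) * (v1 ^ 2 + v2 ^ 2 + v3 ^ 2).
Proof.
  intros HP HV. set (k := w1 * p1 + w2 * p2 + w3 * p3).
  set (n1 := w1 - k * p1). set (n2 := w2 - k * p2). set (n3 := w3 - k * p3).
  assert (E1 : w1 * v1 + w2 * v2 + w3 * v3 = n1 * v1 + n2 * v2 + n3 * v3).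
  { unfold n1, n2, n3. transitivity (w1 * v1 + w2 * v2 + w3 * v3 - k * (p1 * v1 + p2 * v2 + p3 * v3));
      [rewrite HV|]; ring. }
  assert (E2 : w1 ^ 2 + w2 ^ 2 + w3 ^ 2 - k ^ 2 = n1 ^ 2 + n2 ^ 2 + n3 ^ 2).
  { unfold n1, n2, n3.
    transitivity (w1 ^ 2 + w2 ^ 2 + w3 ^ 2 - 2 * k * (w1 * p1 + w2 * p2 + w3 * p3)
      + k ^ 2 * (p1 ^ 2 + p2 ^ 2 + p3 ^ 2)); [|ring].
    rewrite HP. fold k. ring. }
  rewrite E1, E2. clearbody n1 n2 n3.
  pose proof (pow2_ge_0 (n1 * v2 - n2 * v1)). pose proof (pow2_ge_0 (n1 * v3 - n3 * v1)).
  pose proof (pow2_ge_0 (n2 * v3 - n3 * v2)). nra.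
Qed.

(** * The calibration *)

(* Along the great circles through [(c, s, 0)] the function
   [sqrt (1 - u^2) * calib], [u = c x1 + s x2], has derivative [phi] minus a
   nonnegative function (see [transport_eq]).  In gnomonic coordinates [calib] is
   [(s B_y - c B_x) / (s^2 X3)]; [calib_1], [calib_2], [calib_3] are its partial
   derivatives as a function on R^3. *)
Definition calib (l c s x1 x2 x3 : R) : R :=
  - 2 / s ^ 2 * x3 ^ 2 / quad l x1 ^ 2 * (s * x2 - c * l * x1).
Definition calib_1 (l c s x1 x2 x3 : R) : R :=
  - 2 / s ^ 2 * x3 ^ 2 *
    (- c * l / quad l x1 ^ 2 + 4 * (1 - l) * x1 * (s * x2 - c * l * x1) / quad l x1 ^ 3).
Definition calib_2 (l s x1 x3 : R) : R := - 2 / s * x3 ^ 2 / quad l x1 ^ 2.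
Definition calib_3 (l c s x1 x2 x3 : R) : R :=
  - 4 / s ^ 2 * x3 / quad l x1 ^ 2 * (s * x2 - c * l * x1).

(** The derivative of [calib] in the direction [th - u P], where [th = (c, s, 0)]. This is the
    projection of [th] to the tangent plane at [P]; it has length [sqrt (1 - u^2)] and is tangent to
    the great circle through [th]. *)
Definition calib_transport (l c s x1 x2 x3 : R) : R :=
  c * calib_1 l c s x1 x2 x3 + s * calib_2 l s x1 x3
  - (c * x1 + s * x2) * (x1 * calib_1 l c s x1 x2 x3 + x2 * calib_2 l s x1 x3 + x3 * calib_3 l c s x1 x2 x3).

(** The left side is the derivative of [sqrt (1 - u^2) * calib] along the unit tangent towards [th],
    as [sqrt (1 - u^2)] itself has derivative [- u]. The subtracted term is
    [(K N + (c/s)^2 B_xx) / X3^2] in gnomonic coordinates. *)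
Lemma transport_eq (l K c s x1 x2 x3 : R) : s <> 0 -> quad l x1 <> 0 ->
  calib_transport l c s x1 x2 x3 - (c * x1 + s * x2) * calib l c s x1 x2 x3 =
  phi l K x1 x2 x3
  - 2 * l * x3 ^ 2 / quad l x1 ^ 2 * (K - c ^ 2 / s ^ 2 * (1 - 4 * l * x1 ^ 2 / quad l x1)).
Proof.
  intros Hs HS. unfold calib_transport, calib, calib_1, calib_2, calib_3, phi.
  assert (E : (1 - l) * x1 ^ 2 = 1 - quad l x1) by (unfold quad; ring).
  set (S := quad l x1) in *. clearbody S. set (L := s * x2 - c * l * x1).
  transitivity (- 2 * x3 ^ 2 / s ^ 2 * ((s ^ 2 - c ^ 2 * l) / S ^ 2
     + 4 * L * (c * (1 - l) * x1 - (c * x1 + s * x2) * ((1 - l) * x1 ^ 2 + S)) / S ^ 3)).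
  - unfold L; field; split; assumption.
  - rewrite E. unfold L; field; split; assumption.
Qed.

Lemma Rabs_mult_le (x y p q : R) : Rabs x <= p -> Rabs y <= q -> Rabs (x * y) <= p * q.
Proof. intros. rewrite Rabs_mult. apply Rmult_le_compat; auto using Rabs_pos. Qed.

Lemma Rabs_plus_le (x y p q : R) : Rabs x <= p -> Rabs y <= q -> Rabs (x + y) <= p + q.
Proof. intros. eapply Rle_trans; [apply Rabs_triang|lra]. Qed.

Lemma Rabs_le_1 (x : R) : x ^ 2 <= 1 -> Rabs x <= 1.
Proof. intros H. apply Rabs_le. nra. Qed.

(** The factor [|x3|] is essential: it makes the second-order errors multiples of [x3^2], as in the
    correction term of the conformal factor. The denominators are at worst [s^2 quad^3]; 18 comes
    from [calib_1], as [2 * (1 + 8)]. *)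
Lemma calib_bounds (l s0 c s x1 x2 x3 : R) :
  0 < l <= 1 -> 0 < s0 -> s0 <= Rabs s -> c ^ 2 + s ^ 2 = 1 ->
  x1 ^ 2 + x2 ^ 2 + x3 ^ 2 = 1 ->
  let M := 18 / (s0 ^ 2 * l ^ 3) in
  Rabs (calib l c s x1 x2 x3) <= M * Rabs x3 /\ Rabs (calib_1 l c s x1 x2 x3) <= M * Rabs x3 /\
  Rabs (calib_2 l s x1 x3) <= M * Rabs x3 /\ Rabs (calib_3 l c s x1 x2 x3) <= M * Rabs x3.
Proof.
  intros Hl Hs0 Hs Hcs HP M.
  assert (Hx1 : x1 ^ 2 <= 1) by nra.
  pose proof (quad_bounds l x1 Hl Hx1) as HS.
  assert (B1 := Rabs_le_1 x1 Hx1).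
  assert (B2 : Rabs x2 <= 1) by (apply Rabs_le_1; nra).
  assert (B3 : Rabs x3 <= 1) by (apply Rabs_le_1; nra).
  assert (Bc : Rabs c <= 1) by (apply Rabs_le_1; nra).
  assert (Bs : Rabs s <= 1) by (apply Rabs_le_1; nra).
  assert (Bl : Rabs l <= 1) by (apply Rabs_le; lra).
  assert (Bk : Rabs (1 - l) <= 1) by (apply Rabs_le; lra).
  assert (Ns : s <> 0) by (intros ->; rewrite Rabs_R0 in Hs; lra).
  assert (Hs2 : s0 ^ 2 <= s ^ 2) by (rewrite <- (pow2_abs s); apply pow_incr; lra).
  assert (Hs02 : 0 < s0 ^ 2) by (apply pow_lt; exact Hs0).
  unfold calib, calib_1, calib_2, calib_3. set (S := quad l x1) in *. clearbody S.
  assert (BS : Rabs S <= 1) by (apply Rabs_le; lra).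
  assert (BL : Rabs (s * x2 - c * l * x1) <= 2).
  { unfold Rminus. replace 2 with (1 * 1 + 1 * 1 * 1) by ring. apply Rabs_plus_le.
    - apply Rabs_mult_le; assumption.
    - rewrite Rabs_Ropp. repeat first [assumption | apply Rabs_mult_le]. }
  set (L := s * x2 - c * l * x1) in *. clearbody L.
  assert (Hl3 : l ^ 3 <= S ^ 3) by (apply pow_incr; lra).
  assert (Hl3p : 0 < l ^ 3) by (apply pow_lt; lra).
  assert (HT : 0 < / (s ^ 2 * S ^ 3) <= / (s0 ^ 2 * l ^ 3)).
  { split; [apply Rinv_0_lt_compat, Rmult_lt_0_compat; lra|].
    apply Rinv_le_contravar; [apply Rmult_lt_0_compat; lra | apply Rmult_le_compat; lra]. }
  assert (F : forall v, Rabs v <= 18 -> Rabs (/ (s ^ 2 * S ^ 3) * v * x3) <= M * Rabs x3).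
  { intros v Hv. apply Rabs_mult_le; [|lra]. unfold M, Rdiv. rewrite (Rmult_comm 18).
    apply Rabs_mult_le; [|exact Hv]. rewrite Rabs_right; lra. }
  assert (C2 : Rabs (- 2) <= 2) by (apply Rabs_le; lra).
  assert (C4 : Rabs 4 <= 4) by (apply Rabs_le; lra).
  assert (C4' : Rabs (- 4) <= 4) by (apply Rabs_le; lra).
  assert (Bc' : Rabs (- c) <= 1) by (rewrite Rabs_Ropp; exact Bc).
  repeat split.
  - replace (- 2 / s ^ 2 * x3 ^ 2 / S ^ 2 * L) with (/ (s ^ 2 * S ^ 3) * (- 2 * x3 * S * L) * x3)
      by (field; lra).
    apply F. apply Rle_trans with (2 * 1 * 1 * 2); [|lra]. repeat first [assumption | apply Rabs_mult_le].
  - replace (- 2 / s ^ 2 * x3 ^ 2 * (- c * l / S ^ 2 + 4 * (1 - l) * x1 * L / S ^ 3))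
      with (/ (s ^ 2 * S ^ 3) * (- 2 * x3 * (- c * l * S + 4 * (1 - l) * x1 * L)) * x3)
      by (field; lra).
    apply F. apply Rle_trans with (2 * 1 * (1 * 1 * 1 + 4 * 1 * 1 * 2)); [|lra].
    apply Rabs_mult_le; [apply Rabs_mult_le; assumption|].
    apply Rabs_plus_le; repeat first [assumption | apply Rabs_mult_le].
  - replace (- 2 / s * x3 ^ 2 / S ^ 2) with (/ (s ^ 2 * S ^ 3) * (- 2 * x3 * S * s) * x3)
      by (field; lra).
    apply F. apply Rle_trans with (2 * 1 * 1 * 1); [|lra]. repeat first [assumption | apply Rabs_mult_le].
  - replace (- 4 / s ^ 2 * x3 / S ^ 2 * L) with (/ (s ^ 2 * S ^ 3) * (- 4 * S * L) * x3)
      by (field; lra).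
    apply F. apply Rle_trans with (4 * 1 * 2); [|lra]. repeat first [assumption | apply Rabs_mult_le].
Qed.

(* With [asin (q u)] in place of [asin u] the leading term is [r q^2] instead of
   [1]; the gain [1 - r q^2] absorbs the errors of first order in [e] caused by
   [q < 1], uniformly in [q]. *)
Lemma perturb_ineq (r q e u A D N M z : R) :
  0 <= r <= 1 -> 0 < q < 1 -> -1 <= u <= 1 -> 0 <= e -> e * M <= 1 / 8 -> 0 <= M ->
  0 <= z <= 1 -> - (M * z) <= A <= M * z -> - (2 * (M * z)) <= D <= 2 * (M * z) ->
  N <= 3 * (M * z) ^ 2 ->
  r * (q - e * q ^ 2 * u * A) ^ 2 + 2 * e * (q - e * q ^ 2 * u * A) * D + e ^ 2 * N
  <= 1 + 2 * e * (D - u * A) + 8 * M ^ 2 * e ^ 2 * z ^ 2.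
Proof.
  intros Hr Hq Hu He HeM HM Hz HA HD HN.
  assert (Hm : 0 <= M * z <= M) by nra.
  assert (Q : 0 < q ^ 2 < 1) by nra.
  assert (R2 : 0 <= r * q ^ 2 <= q ^ 2) by nra.
  set (m := M * z) in *.
  assert (UA : - m <= u * A <= m) by nra.
  set (v := u * A) in *.
  assert (P1 : 1 - r * q ^ 3 <= 2 * (1 - r * q ^ 2)).
  { replace (r * q ^ 3) with (r * q ^ 2 * q) by ring. nra. }
  assert (P1' : 0 <= 1 - r * q ^ 3).
  { replace (r * q ^ 3) with (r * q ^ 2 * q) by ring. nra. }
  assert (P2 : 1 - q <= 1 - r * q ^ 2) by nra.
  assert (Hem : 0 <= e * m <= 1 / 8) by nra.
  assert (T1 : e * v * (1 - r * q ^ 3) <= e * m * (2 * (1 - r * q ^ 2))).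
  { apply Rle_trans with (e * m * (1 - r * q ^ 3)).
    - apply Rmult_le_compat_r; [lra|]. apply Rmult_le_compat_l; lra.
    - apply Rmult_le_compat_l; lra. }
  assert (T2 : e * (- D) * (1 - q) <= e * (2 * m) * (1 - r * q ^ 2)).
  { apply Rle_trans with (e * (2 * m) * (1 - q)).
    - apply Rmult_le_compat_r; [lra|]. apply Rmult_le_compat_l; lra.
    - apply Rmult_le_compat_l; nra. }
  (* [T1] and [T2] each count twice and add up to [8 e m (1 - r q^2)], which the gain [1 - r q^2]
     covers exactly when [e m <= 1/8]. *)
  assert (T3 : e * m * (1 - r * q ^ 2) <= 1 / 8 * (1 - r * q ^ 2)) by (apply Rmult_le_compat_r; lra).
  assert (S1 : r * q ^ 4 * v ^ 2 <= m ^ 2).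
  { replace (r * q ^ 4) with (r * q ^ 2 * q ^ 2) by ring.
    assert (v ^ 2 <= m ^ 2) by nra. assert (0 <= r * q ^ 2 * q ^ 2 <= 1) by nra. nra. }
  assert (S2 : - (q ^ 2 * v * D) <= 2 * m ^ 2).
  { assert (- (v * D) <= 2 * m ^ 2) by nra.
    assert (0 <= m ^ 2) by nra.
    replace (- (q ^ 2 * v * D)) with (q ^ 2 * (- (v * D))) by ring. nra. }
  assert (E2 : 0 <= e ^ 2) by nra.
  replace (M ^ 2 * e ^ 2 * z ^ 2) with (e ^ 2 * m ^ 2) by (unfold m; ring).
  replace (8 * M ^ 2 * e ^ 2 * z ^ 2) with (e ^ 2 * (8 * m ^ 2)) by (unfold m; ring).
  (* The 8 is [1 + 2 * 2 + 3], from [S1], from [S2] taken twice, and from the bound on [N]. *)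
  assert (S3 : e ^ 2 * (r * q ^ 4 * v ^ 2 + 2 * (- (q ^ 2 * v * D)) + N) <= e ^ 2 * (8 * m ^ 2))
    by (apply Rmult_le_compat_l; lra).
  replace (r * (q - e * q ^ 2 * u * A) ^ 2 + 2 * e * (q - e * q ^ 2 * u * A) * D + e ^ 2 * N)
    with (r * q ^ 2 - 2 * e * (r * q ^ 3) * v + 2 * e * q * D
       + e ^ 2 * (r * q ^ 4 * v ^ 2 + 2 * (- (q ^ 2 * v * D)) + N)) by (unfold v; ring).
  lra.
Qed.

(** * The perturbed metric and its two length bounds *)

Definition cfactor (l K C e a b x y : R) : R :=
  1 + 2 * e * phi l K (X1 a b x y) (X2 a b x y) (X3 x y) + C * e ^ 2 * X3 x y ^ 2.
Definition cmetric (l K C e a b : R) : metric_tensor :=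
  conformal (fun x y => cfactor l K C e a b x y * sph_density x y).

Lemma cfactor_smooth (l K C e a b : R) : 0 < l <= 1 -> a ^ 2 + b ^ 2 = 1 ->
  smooth2 (cfactor l K C e a b).
Proof.
  intros Hl H. unfold cfactor.
  apply smooth2_plus; [apply smooth2_plus|]; [smooth | | smooth].
  apply smooth2_mult; [apply smooth2_const | apply phi_smooth; assumption].
Qed.

Lemma rho_arg (q u : R) : 0 < q < 1 -> u ^ 2 <= 1 -> 0 < 1 - (q * u) ^ 2.
Proof. intros Hq Hu. replace ((q * u) ^ 2) with (q ^ 2 * u ^ 2) by ring. nra. Qed.

Lemma is_derive_asin_scal (m q : R) (u : R -> R) (t u' : R) : 0 < q < 1 -> u t ^ 2 <= 1 ->
  is_derive u t u' ->
  is_derive (fun t => m * asin (q * u t)) t (m * (q * u' / sqrt (1 - (q * u t) ^ 2))).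
Proof.
  intros Hq Hu H. pose proof (rho_arg q _ Hq Hu) as HR.
  apply (is_derive_scal (fun t => asin (q * u t))).
  apply (is_derive_comp asin (fun t => q * u t) t (/ sqrt (1 - (q * u t) ^ 2)) (q * u')).
  - apply is_derive_asin. nra.
  - apply (is_derive_scal u), H.
Qed.

Lemma is_derive_calib (l c s : R) (x1 x2 x3 : R -> R) (t d1 d2 d3 : R) :
  s <> 0 -> quad l (x1 t) <> 0 ->
  is_derive x1 t d1 -> is_derive x2 t d2 -> is_derive x3 t d3 ->
  is_derive (fun t => calib l c s (x1 t) (x2 t) (x3 t)) t
    (calib_1 l c s (x1 t) (x2 t) (x3 t) * d1 + calib_2 l s (x1 t) (x3 t) * d2
     + calib_3 l c s (x1 t) (x2 t) (x3 t) * d3).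
Proof.
  intros Hs HS H1 H2 H3. unfold calib, calib_1, calib_2, calib_3, quad in *. auto_derive.
  - repeat split; try (eexists; eassumption).
    simpl in HS. repeat apply Rmult_integral_contrapositive_currified; try assumption; lra.
  - rewrite (is_derive_unique (fun u : R => x1 u) _ _ H1), (is_derive_unique (fun u : R => x2 u) _ _ H2),
      (is_derive_unique (fun u : R => x3 u) _ _ H3).
    field. split; assumption.
Qed.

Lemma is_derive_rho (q : R) (u f : R -> R) (t u' f' : R) : 0 < q < 1 -> u t ^ 2 <= 1 ->
  is_derive u t u' -> is_derive f t f' ->
  is_derive (fun t => sqrt (1 - (q * u t) ^ 2) * f t) t
    (sqrt (1 - (q * u t) ^ 2) * f' - q ^ 2 * u t * u' / sqrt (1 - (q * u t) ^ 2) * f t).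
Proof.
  intros Hq Hu Du Df. pose proof (rho_arg q _ Hq Hu) as HR. pose proof (sqrt_lt_R0 _ HR).
  auto_derive.
  - repeat split; try (eexists; eassumption). simpl in HR. lra.
  - rewrite (is_derive_unique (fun x : R => u x) _ _ Du), (is_derive_unique (fun x : R => f x) _ _ Df).
    replace (1 - q * u t * (q * u t * 1)) with (1 - (q * u t) ^ 2) by ring.
    set (r := sqrt _) in *. field. lra.
Qed.

Lemma circle_X (a b : R) (p : R * R) : on_circle p ->
  X1 a b (fst p) (snd p) = along a b (fst p) (snd p) /\
  X2 a b (fst p) (snd p) = across a b (fst p) (snd p) /\ X3 (fst p) (snd p) = 0.
Proof.
  unfold on_circle. intros H.
  assert (E : den (fst p) (snd p) = 2) by (unfold den; lra).
  assert (E' : 1 - fst p ^ 2 - snd p ^ 2 = 0) by lra.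
  unfold X1, X2, X3. rewrite E, E'. repeat split; field.
Qed.

Lemma dot_le_1 (x1 x2 x3 c s : R) : c ^ 2 + s ^ 2 = 1 -> x1 ^ 2 + x2 ^ 2 + x3 ^ 2 = 1 ->
  (c * x1 + s * x2) ^ 2 <= 1.
Proof.
  intros Hc Hx. pose proof (pow2_ge_0 (c * x2 - s * x1)). pose proof (pow2_ge_0 x3).
  assert ((c * x1 + s * x2) ^ 2 + (c * x2 - s * x1) ^ 2 = (c ^ 2 + s ^ 2) * (x1 ^ 2 + x2 ^ 2)) by ring.
  rewrite Hc in *. lra.
Qed.

(** Calibration by [m asin u] alone, from the pointwise bound on the conformal factor. It serves
    directions close to the axis, including [s = 0], where [calib] is singular. *)
Lemma length_ge_weak (l K C e a b c s m : R) (c1 c2 : R -> R) (p p' : R * R) :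
  0 < l <= 1 -> a ^ 2 + b ^ 2 = 1 -> c ^ 2 + s ^ 2 = 1 -> 0 <= m ->
  (forall x y, in_disc (x, y) -> m ^ 2 <= cfactor l K C e a b x y) ->
  on_circle p -> on_circle p' -> curve_in_disc c1 c2 p p' ->
  m * (asin (c * along a b (fst p) (snd p) + s * across a b (fst p) (snd p))
       - asin (c * along a b (fst p') (snd p') + s * across a b (fst p') (snd p')))
  <= curve_length (cmetric l K C e a b) c1 c2.
Proof.
  intros Hl H Hcs Hm Hf Hp Hp' [HC [Hin [H0 H1]]].
  set (x1 := fun t => X1 a b (c1 t) (c2 t)). set (x2 := fun t => X2 a b (c1 t) (c2 t)).
  set (x3 := fun t => X3 (c1 t) (c2 t)).
  set (u := fun t => c * x1 t + s * x2 t).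
  assert (HE : forall t, x1 t ^ 2 + x2 t ^ 2 + x3 t ^ 2 = 1) by (intros; apply sphere_eq, H).
  assert (Hu : forall t, u t ^ 2 <= 1) by (intros t; exact (dot_le_1 _ _ _ c s Hcs (HE t))).
  assert (U0 : u 0 = c * along a b (fst p) (snd p) + s * across a b (fst p) (snd p)).
  { destruct (circle_X a b p Hp) as [E1 [E2 _]]. unfold u, x1, x2. rewrite <- E1, <- E2, <- H0. reflexivity. }
  assert (U1 : u 1 = c * along a b (fst p') (snd p') + s * across a b (fst p') (snd p')).
  { destruct (circle_X a b p' Hp') as [E1 [E2 _]]. unfold u, x1, x2. rewrite <- E1, <- E2, <- H1. reflexivity. }
  rewrite <- U0, <- U1.
  apply asin_diff_limit; [exact Hm | pose proof (Hu 0); nra | pose proof (Hu 1); nra |].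
  intros q Hq.
  set (d1 := fun t => dX1 a b (c1 t) (c2 t) (Derive c1 t) (Derive c2 t)).
  set (d2 := fun t => dX2 a b (c1 t) (c2 t) (Derive c1 t) (Derive c2 t)).
  set (d3 := fun t => dX3 (c1 t) (c2 t) (Derive c1 t) (Derive c2 t)).
  set (G := fun t => m * asin (q * u t)).
  replace (m * (asin (q * u 0) - asin (q * u 1))) with (G 0 - G 1) by (unfold G; ring).
  apply curve_length_ge with (G' := fun t => m * (q * (c * d1 t + s * d2 t) / sqrt (1 - (q * u t) ^ 2))).
  - apply continuous2_mult; apply smooth2_continuous2; [apply cfactor_smooth; assumption | apply sph_density_smooth].
  - exact HC.
  - intros t _. apply is_derive_asin_scal; [exact Hq | apply Hu |].
    destruct (is_derive_X a b c1 c2 t (proj1 (proj1 HC t)) (proj2 (proj1 HC t))) as [D1 [D2 _]].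
    apply (is_derive_plus (V := R_NormedModule) (fun t => c * x1 t) (fun t => s * x2 t));
      [apply (is_derive_scal x1), D1 | apply (is_derive_scal x2), D2].
  - intros t Ht. pose proof (rho_arg q _ Hq (Hu t)) as HR.
    pose proof (sqrt_lt_R0 _ HR) as Hr. pose proof (pow2_sqrt _ (Rlt_le _ _ HR)) as Hr2.
    pose proof (tangent_cauchy_schwarz (x1 t) (x2 t) (x3 t) (d1 t) (d2 t) (d3 t) c s 0 (HE t)
      (velocity_tangent a b _ _ _ _ H)) as CS.
    rewrite (velocity_norm a b _ _ _ _ H : d1 t ^ 2 + d2 t ^ 2 + d3 t ^ 2 = _) in CS.
    replace (c * d1 t + s * d2 t + 0 * d3 t) with (c * d1 t + s * d2 t) in CS by ring.
    replace (c ^ 2 + s ^ 2 + 0 ^ 2 - (c * x1 t + s * x2 t + 0 * x3 t) ^ 2) with (1 - u t ^ 2) in CS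
      by (unfold u; rewrite <- Hcs; ring).
    set (r := sqrt (1 - (q * u t) ^ 2)) in *.
    set (du := c * d1 t + s * d2 t) in *.
    set (v2 := Derive c1 t ^ 2 + Derive c2 t ^ 2) in *.
    assert (Hv : 0 <= sph_density (c1 t) (c2 t) * v2).
    { apply Rmult_le_pos; [|unfold v2; nra]. unfold sph_density.
      apply Rlt_le, Rdiv_lt_0_compat; [lra | apply pow_lt, stereo_den_pos]. }
    specialize (Hf _ _ (Hin t Ht)).
    apply Rle_trans with (m ^ 2 * (sph_density (c1 t) (c2 t) * v2)).
    + replace ((m * (q * du / r)) ^ 2) with (m ^ 2 * (q ^ 2 * du ^ 2 / r ^ 2)) by (field; lra).
      apply Rmult_le_compat_l; [nra|].
      apply Rle_div_l; [nra|]. rewrite Hr2.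
      apply Rle_trans with (q ^ 2 * ((1 - u t ^ 2) * (sph_density (c1 t) (c2 t) * v2))).
      * apply Rmult_le_compat_l; [nra | exact CS].
      * replace (q ^ 2 * ((1 - u t ^ 2) * (sph_density (c1 t) (c2 t) * v2)))
          with (sph_density (c1 t) (c2 t) * v2 * (q ^ 2 - (q * u t) ^ 2)) by ring.
        apply Rmult_le_compat_l; [exact Hv | nra].
    + rewrite Rmult_assoc. apply Rmult_le_compat_r; assumption.
Qed.

(** [(w1, w2, w3)] is the ambient gradient of [asin (q u) + e r calib]; [k] collects its part along
    [(c, s, 0)], from the arcsine and from differentiating [r]. Removing the radial component leaves
    the squared tangential gradient, and the bound is the conformal factor with [K = 1 / s0^2] and
    [C = 8 M^2]. *)
Lemma calibration_grad (l s0 e q c s x1 x2 x3 : R) :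
  0 < l <= 1 -> 0 < s0 -> s0 <= Rabs s -> c ^ 2 + s ^ 2 = 1 ->
  x1 ^ 2 + x2 ^ 2 + x3 ^ 2 = 1 -> 0 < q < 1 -> 0 <= e ->
  let M := 18 / (s0 ^ 2 * l ^ 3) in e * M <= 1 / 8 ->
  let u := c * x1 + s * x2 in
  let A := calib l c s x1 x2 x3 in
  let r := sqrt (1 - (q * u) ^ 2) in
  let k := (q - e * q ^ 2 * u * A) / r in
  let w1 := k * c + e * r * calib_1 l c s x1 x2 x3 in
  let w2 := k * s + e * r * calib_2 l s x1 x3 in
  let w3 := e * r * calib_3 l c s x1 x2 x3 in
  w1 ^ 2 + w2 ^ 2 + w3 ^ 2 - (w1 * x1 + w2 * x2 + w3 * x3) ^ 2 <=
  1 + 2 * e * phi l (/ s0 ^ 2) x1 x2 x3 + 8 * M ^ 2 * e ^ 2 * x3 ^ 2.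
Proof.
  intros Hl Hs0 Hs Hcs HP Hq He M HeM u A r k w1 w2 w3.
  destruct (calib_bounds l s0 c s x1 x2 x3 Hl Hs0 Hs Hcs HP) as [BA [B1 [B2 B3]]].
  fold M in BA, B1, B2, B3. fold A in BA.
  assert (Hu : u ^ 2 <= 1) by exact (dot_le_1 _ _ _ c s Hcs HP).
  pose proof (rho_arg q u Hq Hu) as HR. pose proof (sqrt_lt_R0 _ HR) as Hr.
  pose proof (pow2_sqrt _ (Rlt_le _ _ HR)) as Hr2. fold r in Hr, Hr2.
  assert (HM : 0 <= M).
  { unfold M. apply Rlt_le, Rdiv_lt_0_compat; [lra|].
    apply Rmult_lt_0_compat; apply pow_lt; lra. }
  assert (Hx3 : 0 <= Rabs x3 <= 1).
  { split; [apply Rabs_pos | apply Rabs_le_1; nra]. }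
  assert (Ns : s <> 0) by (intros ->; rewrite Rabs_R0 in Hs; lra).
  assert (HS : 0 < quad l x1).
  { assert (Hx1 : x1 ^ 2 <= 1) by nra. pose proof (quad_bounds l x1 Hl Hx1). lra. }
  assert (T := transport_eq l (/ s0 ^ 2) c s x1 x2 x3 Ns (Rgt_not_eq _ _ HS)).
  set (D := calib_transport l c s x1 x2 x3) in *. fold u A in T.
  set (g1 := calib_1 l c s x1 x2 x3) in *. set (g2 := calib_2 l s x1 x3) in *.
  set (g3 := calib_3 l c s x1 x2 x3) in *.
  assert (ED : D = c * g1 + s * g2 - u * (x1 * g1 + x2 * g2 + x3 * g3)) by reflexivity.
  set (m := M * Rabs x3) in *.
  assert (Sqr : forall y, Rabs y <= m -> y ^ 2 <= m ^ 2).
  { intros y Hy. rewrite <- (pow2_abs y). apply pow_incr. split; [apply Rabs_pos | exact Hy]. }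
  assert (Hm : 0 <= m) by (apply Rmult_le_pos; lra).
  pose proof (Sqr _ B1) as Q1. pose proof (Sqr _ B2) as Q2. pose proof (Sqr _ B3) as Q3.
  (* Cauchy-Schwarz: [D] pairs the gradient, of length at most [sqrt 3 * m], with [th - u P], of
     length at most 1. *)
  assert (BD : - (2 * m) <= D <= 2 * m).
  { apply Rabs_le_between. rewrite <- (Rabs_pos_eq (2 * m)) by lra. apply Rsqr_le_abs_0.
    unfold Rsqr.
    pose proof (pow2_ge_0 ((c - u * x1) * g2 - (s - u * x2) * g1)).
    pose proof (pow2_ge_0 ((c - u * x1) * g3 - (- u * x3) * g1)).
    pose proof (pow2_ge_0 ((s - u * x2) * g3 - (- u * x3) * g2)).
    assert (N : (c - u * x1) ^ 2 + (s - u * x2) ^ 2 + (- u * x3) ^ 2 = 1 - u ^ 2).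
    { transitivity (c ^ 2 + s ^ 2 - 2 * u * (c * x1 + s * x2) + u ^ 2 * (x1 ^ 2 + x2 ^ 2 + x3 ^ 2)); [ring|].
      rewrite HP, Hcs. fold u. ring. }
    assert (L : D * D <= (1 - u ^ 2) * (g1 ^ 2 + g2 ^ 2 + g3 ^ 2)).
    { rewrite <- N, ED.
      match goal with |- ?lhs <= ?rhs => assert (rhs - lhs =
        ((c - u * x1) * g2 - (s - u * x2) * g1) ^ 2 + ((c - u * x1) * g3 - (- u * x3) * g1) ^ 2
        + ((s - u * x2) * g3 - (- u * x3) * g2) ^ 2) by ring end.
      lra. }
    assert (0 <= 1 - u ^ 2 <= 1) by (pose proof (pow2_ge_0 u); lra).
    assert (0 <= g1 ^ 2 + g2 ^ 2 + g3 ^ 2 <= 3 * m ^ 2).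
    { pose proof (pow2_ge_0 g1). pose proof (pow2_ge_0 g2). pose proof (pow2_ge_0 g3). lra. }
    nra. }
  set (pg := x1 * g1 + x2 * g2 + x3 * g3) in *.
  set (N := r ^ 2 * (g1 ^ 2 + g2 ^ 2 + g3 ^ 2 - pg ^ 2)).
  assert (HN : N <= 3 * m ^ 2).
  { unfold N. pose proof (pow2_ge_0 pg).
    assert (0 <= r ^ 2 <= 1) by (rewrite Hr2; pose proof (pow2_ge_0 (q * u)); split; lra).
    apply Rle_trans with (r ^ 2 * (3 * m ^ 2)); [apply Rmult_le_compat_l; lra|].
    pose proof (pow2_ge_0 m). nra. }
  (* The quotient [(1 - u^2) / r^2] is the parameter called [r] in [perturb_ineq]. *)
  assert (E : w1 ^ 2 + w2 ^ 2 + w3 ^ 2 - (w1 * x1 + w2 * x2 + w3 * x3) ^ 2 =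
    (1 - u ^ 2) / r ^ 2 * (q - e * q ^ 2 * u * A) ^ 2
    + 2 * e * (q - e * q ^ 2 * u * A) * D + e ^ 2 * N).
  { transitivity (k ^ 2 * (c ^ 2 + s ^ 2 - u ^ 2) + 2 * e * (k * r) * D + e ^ 2 * N).
    - rewrite ED. unfold w1, w2, w3, N.
      replace ((k * c + e * r * g1) * x1 + (k * s + e * r * g2) * x2 + e * r * g3 * x3)
        with (k * u + e * r * pg) by (unfold u, pg; ring).
      ring.
    - rewrite Hcs. unfold k. field. lra. }
  rewrite E.
  eapply Rle_trans.
  - apply (perturb_ineq _ q e u A D N M (Rabs x3)); try assumption.
    + split.
      * apply Rmult_le_pos; [lra | apply Rlt_le, Rinv_0_lt_compat; nra].
      * apply Rle_div_l; [nra|]. rewrite Hr2.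
        replace ((q * u) ^ 2) with (q ^ 2 * u ^ 2) by ring. pose proof (pow2_ge_0 u). assert (q ^ 2 * u ^ 2 <= 1 * u ^ 2) by (apply Rmult_le_compat_r; nra). lra.
    + nra.
    + apply Rabs_le_between. exact BA.
  - rewrite pow2_abs. rewrite T.
    (* Here the threshold acts: [c^2 / s^2 <= 1 / s^2 <= 1 / s0^2 = K]. *)
    assert (B : 0 <= 2 * l * x3 ^ 2 / quad l x1 ^ 2 *
      (/ s0 ^ 2 - c ^ 2 / s ^ 2 * (1 - 4 * l * x1 ^ 2 / quad l x1))).
    { apply Rmult_le_pos.
      - apply Rmult_le_pos; [|apply Rlt_le, Rinv_0_lt_compat, pow_lt, HS].
        apply Rmult_le_pos; [lra | apply pow2_ge_0].
      - assert (s0 ^ 2 <= s ^ 2) by (rewrite <- (pow2_abs s); apply pow_incr; lra).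
        assert (0 < s0 ^ 2) by (apply pow_lt; exact Hs0).
        assert (I1 : / s ^ 2 <= / s0 ^ 2) by (apply Rinv_le_contravar; lra).
        assert (I2 : 0 < / s ^ 2) by (apply Rinv_0_lt_compat; lra).
        assert (I3 : 0 <= 4 * l * x1 ^ 2 / quad l x1).
        { apply Rmult_le_pos; [|apply Rlt_le, Rinv_0_lt_compat, HS].
          apply Rmult_le_pos; [lra | apply pow2_ge_0]. }
        assert (I4 : 0 <= c ^ 2 / s ^ 2 <= / s ^ 2).
        { unfold Rdiv. pose proof (pow2_ge_0 c). pose proof (pow2_ge_0 s). split; nra. }
        nra. }
    set (bb := 2 * l * x3 ^ 2 / _ * _) in *. nra.
Qed.

(** [calib] vanishes on the boundary, where [X3 = 0]. The perturbed calibration thus has the same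
    end values as the round one, and for these directions the round bound survives without loss. *)
Lemma length_ge_strong (l s0 e a b c s : R) (c1 c2 : R -> R) (p p' : R * R) :
  0 < l <= 1 -> a ^ 2 + b ^ 2 = 1 -> c ^ 2 + s ^ 2 = 1 -> 0 < s0 -> s0 <= Rabs s -> 0 <= e ->
  let M := 18 / (s0 ^ 2 * l ^ 3) in e * M <= 1 / 8 ->
  on_circle p -> on_circle p' -> curve_in_disc c1 c2 p p' ->
  asin (c * along a b (fst p) (snd p) + s * across a b (fst p) (snd p))
  - asin (c * along a b (fst p') (snd p') + s * across a b (fst p') (snd p'))
  <= curve_length (cmetric l (/ s0 ^ 2) (8 * M ^ 2) e a b) c1 c2.
Proof.
  intros Hl H Hcs Hs0 Hs He M HeM Hp Hp' [HC [Hin [H0 H1]]].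
  set (x1 := fun t => X1 a b (c1 t) (c2 t)). set (x2 := fun t => X2 a b (c1 t) (c2 t)).
  set (x3 := fun t => X3 (c1 t) (c2 t)).
  set (u := fun t => c * x1 t + s * x2 t).
  set (A := fun t => calib l c s (x1 t) (x2 t) (x3 t)).
  assert (HE : forall t, x1 t ^ 2 + x2 t ^ 2 + x3 t ^ 2 = 1) by (intros; apply sphere_eq, H).
  assert (Hu : forall t, u t ^ 2 <= 1) by (intros t; exact (dot_le_1 _ _ _ c s Hcs (HE t))).
  assert (A0 : forall t, x3 t = 0 -> A t = 0).
  { intros t Ht. unfold A, calib. rewrite Ht. unfold Rdiv. ring. }
  assert (U0 : u 0 = c * along a b (fst p) (snd p) + s * across a b (fst p) (snd p) /\ A 0 = 0).
  { destruct (circle_X a b p Hp) as [E1 [E2 E3]].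
    split; [|apply A0]; unfold u, x1, x2, x3; rewrite <- H0 in *; [rewrite <- E1, <- E2; reflexivity | exact E3]. }
  assert (U1 : u 1 = c * along a b (fst p') (snd p') + s * across a b (fst p') (snd p') /\ A 1 = 0).
  { destruct (circle_X a b p' Hp') as [E1 [E2 E3]].
    split; [|apply A0]; unfold u, x1, x2, x3; rewrite <- H1 in *; [rewrite <- E1, <- E2; reflexivity | exact E3]. }
  destruct U0 as [U0 Z0], U1 as [U1 Z1]. rewrite <- U0, <- U1.
  rewrite <- (Rmult_1_l (asin (u 0) - asin (u 1))).
  apply asin_diff_limit; [lra | pose proof (Hu 0); nra | pose proof (Hu 1); nra |].
  intros q Hq.
  set (d1 := fun t => dX1 a b (c1 t) (c2 t) (Derive c1 t) (Derive c2 t)).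
  set (d2 := fun t => dX2 a b (c1 t) (c2 t) (Derive c1 t) (Derive c2 t)).
  set (d3 := fun t => dX3 (c1 t) (c2 t) (Derive c1 t) (Derive c2 t)).
  set (r := fun t => sqrt (1 - (q * u t) ^ 2)).
  set (G := fun t => 1 * asin (q * u t) + e * (r t * A t)).
  replace (1 * (asin (q * u 0) - asin (q * u 1))) with (G 0 - G 1)
    by (unfold G; rewrite Z0, Z1; ring).
  set (du := fun t => c * d1 t + s * d2 t).
  set (dA := fun t => calib_1 l c s (x1 t) (x2 t) (x3 t) * d1 t + calib_2 l s (x1 t) (x3 t) * d2 t
     + calib_3 l c s (x1 t) (x2 t) (x3 t) * d3 t).
  apply curve_length_ge with (G' := fun t => 1 * (q * du t / r t)
     + e * (r t * dA t - q ^ 2 * u t * du t / r t * A t)).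
  - apply continuous2_mult; apply smooth2_continuous2; [apply cfactor_smooth; assumption | apply sph_density_smooth].
  - exact HC.
  - intros t _.
    destruct (is_derive_X a b c1 c2 t (proj1 (proj1 HC t)) (proj2 (proj1 HC t))) as [D1 [D2 D3]].
    assert (Du : is_derive u t (du t)).
    { apply (is_derive_plus (V := R_NormedModule) (fun t => c * x1 t) (fun t => s * x2 t));
        [apply (is_derive_scal x1), D1 | apply (is_derive_scal x2), D2]. }
    apply (is_derive_plus (V := R_NormedModule) (fun t => 1 * asin (q * u t)) (fun t => e * (r t * A t))).
    + apply is_derive_asin_scal; [exact Hq | apply Hu | exact Du].
    + apply (is_derive_scal (fun t => r t * A t)).
      apply is_derive_rho; [exact Hq | apply Hu | exact Du |].
      apply is_derive_calib; try assumption.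
      * intros ->; rewrite Rabs_R0 in Hs; lra.
      * apply Rgt_not_eq, (quad_pos l a b _ _ Hl H).
  - intros t _. pose proof (rho_arg q _ Hq (Hu t)) as HR.
    pose proof (sqrt_lt_R0 _ HR) as Hr. fold (r t) in Hr.
    pose proof (calibration_grad l s0 e q c s (x1 t) (x2 t) (x3 t) Hl Hs0 Hs Hcs (HE t) Hq He HeM) as CG.
    cbv zeta in CG. fold (u t) in CG. fold (r t) in CG. fold (A t) in CG. fold M in CG.
    set (k := (q - e * q ^ 2 * u t * A t) / r t) in CG.
    set (w1 := k * c + e * r t * calib_1 l c s (x1 t) (x2 t) (x3 t)) in CG.
    set (w2 := k * s + e * r t * calib_2 l s (x1 t) (x3 t)) in CG.
    set (w3 := e * r t * calib_3 l c s (x1 t) (x2 t) (x3 t)) in CG.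
    replace (1 * (q * du t / r t) + e * (r t * dA t - q ^ 2 * u t * du t / r t * A t))
      with (w1 * d1 t + w2 * d2 t + w3 * d3 t)
      by (unfold w1, w2, w3, k, du, dA; field; lra).
    pose proof (tangent_cauchy_schwarz (x1 t) (x2 t) (x3 t) (d1 t) (d2 t) (d3 t) w1 w2 w3 (HE t)
      (velocity_tangent a b _ _ _ _ H)) as CS.
    rewrite (velocity_norm a b _ _ _ _ H : d1 t ^ 2 + d2 t ^ 2 + d3 t ^ 2 = _) in CS.
    eapply Rle_trans; [exact CS|]. rewrite Rmult_assoc. apply Rmult_le_compat_r; [|exact CG].
    apply Rmult_le_pos; [|nra]. unfold sph_density.
    apply Rlt_le, Rdiv_lt_0_compat; [lra | apply pow_lt, stereo_den_pos].
Qed.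

(** * The filling metric *)

Lemma phi_lower (l K x1 x2 x3 : R) : 0 < l <= 1 -> 0 < K -> x1 ^ 2 + x2 ^ 2 + x3 ^ 2 = 1 ->
  - (2 / l ^ 2) <= phi l K x1 x2 x3.
Proof.
  intros Hl HK HP. unfold phi.
  pose proof (pow2_ge_0 x1). pose proof (pow2_ge_0 x2). pose proof (pow2_ge_0 x3).
  pose proof (quad_bounds l x1 Hl ltac:(lra)) as HS. set (S := quad l x1) in *. clearbody S.
  assert (B1 : 0 <= 4 * x2 ^ 2 / S) by (apply Rmult_le_pos; [lra | apply Rlt_le, Rinv_0_lt_compat; lra]).
  assert (B2 : 0 <= 2 * x3 ^ 2 / S ^ 2 <= 2 / l ^ 2).
  { split.
    - apply Rmult_le_pos; [lra | apply Rlt_le, Rinv_0_lt_compat, pow_lt; lra].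
    - apply Rmult_le_compat; [lra | apply Rlt_le, Rinv_0_lt_compat, pow_lt; lra | lra |].
      apply Rinv_le_contravar; [apply pow_lt; lra | apply pow_incr; lra]. }
  assert (0 <= K * l) by (apply Rmult_le_pos; lra). nra.
Qed.

(** The constants are fixed in the order [K], [l], [M], [e], each from the preceding ones, so [s0]
    may be as small and [m] as close to 1 as desired: the lossless bound holds off a narrow cone of
    directions, the bound with loss [m] everywhere. *)
Lemma pinched_metric (a b s0 m : R) : a ^ 2 + b ^ 2 = 1 -> 0 < s0 -> 0 < m < 1 ->
  exists g, riemannian_disc g /\ area_g g < 2 * PI /\
  (forall c s c1 c2 p p', c ^ 2 + s ^ 2 = 1 -> on_circle p -> on_circle p' ->
     curve_in_disc c1 c2 p p' ->
     let gap := asin (c * along a b (fst p) (snd p) + s * across a b (fst p) (snd p))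
       - asin (c * along a b (fst p') (snd p') + s * across a b (fst p') (snd p')) in
     (s0 <= Rabs s -> gap <= curve_length g c1 c2) /\ m * gap <= curve_length g c1 c2).
Proof.
  intros H Hs0 Hm.
  assert (Hs02 : 0 < s0 ^ 2) by (apply pow_lt; exact Hs0).
  assert (HK : 0 < / s0 ^ 2) by (apply Rinv_0_lt_compat; exact Hs02).
  destruct (phi_integral_neg (/ s0 ^ 2) a b HK H) as [l [Hl HI]].
  set (F := fun x y => phi l (/ s0 ^ 2) (X1 a b x y) (X2 a b x y) (X3 x y) * sph_density x y) in HI.
  set (I := disc_int F) in *.
  set (Z := fun x y => X3 x y ^ 2 * sph_density x y).
  set (J := disc_int Z).
  set (M := 18 / (s0 ^ 2 * l ^ 3)).
  assert (Hl2 : 0 < l ^ 2) by (apply pow_lt; lra).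
  assert (HM : 0 < M).
  { apply Rdiv_lt_0_compat; [lra|]. apply Rmult_lt_0_compat; [lra | apply pow_lt; lra]. }
  assert (Hsig : forall x y, 0 < sph_density x y).
  { intros x y. unfold sph_density. apply Rdiv_lt_0_compat; [lra | apply pow_lt, stereo_den_pos]. }
  assert (CF : continuous2 F).
  { apply smooth2_continuous2, smooth2_mult; [apply phi_smooth; assumption | apply sph_density_smooth]. }
  assert (CZ : continuous2 Z) by (apply smooth2_continuous2; unfold Z; smooth).
  assert (HJ : 0 <= J).
  { replace 0 with (disc_int (fun _ _ => 0 * 0)).
    - apply disc_int_le; [apply smooth2_continuous2; smooth | exact CZ |].
      intros x y _. unfold Z. pose proof (Hsig x y). pose proof (pow2_ge_0 (X3 x y)). nra.
    - rewrite (disc_int_scal 0 (fun _ _ => 0)); [ring | apply smooth2_continuous2; smooth]. }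
  (* [e1] gives [e M <= 1/8] for the calibration; [e2] keeps the conformal factor above [m^2], as
     [phi >= - 2 / l^2]; [e3] makes the second-order area term smaller than the first-order gain. *)
  set (e1 := 1 / (8 * M)). set (e2 := (1 - m ^ 2) * l ^ 2 / 4).
  set (e3 := - I / (8 * M ^ 2 * J + 1)).
  assert (HMJ : 0 <= 8 * M ^ 2 * J).
  { apply Rmult_le_pos; [|exact HJ]. pose proof (pow2_ge_0 M). lra. }
  set (e := Rmin e1 (Rmin e2 e3)).
  assert (He1 : 0 < e1) by (apply Rdiv_lt_0_compat; lra).
  assert (He2 : 0 < e2) by (unfold e2; apply Rdiv_lt_0_compat; [apply Rmult_lt_0_compat; nra | lra]).
  assert (He3 : 0 < e3) by (apply Rdiv_lt_0_compat; lra).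
  assert (He : 0 < e) by (repeat apply Rmin_glb_lt; assumption).
  assert (Le1 : e <= e1) by apply Rmin_l.
  assert (Le2 : e <= e2) by (eapply Rle_trans; [apply Rmin_r | apply Rmin_l]).
  assert (Le3 : e <= e3) by (eapply Rle_trans; [apply Rmin_r | apply Rmin_r]).
  clearbody e.
  assert (HeM : e * M <= 1 / 8).
  { apply Rle_trans with (e1 * M); [apply Rmult_le_compat_r; lra|].
    unfold e1. apply Req_le. field. lra. }
  assert (HeJ : e * (8 * M ^ 2 * J) < - I).
  { apply Rle_lt_trans with (e3 * (8 * M ^ 2 * J)); [apply Rmult_le_compat_r; lra|].
    apply Rlt_le_trans with (e3 * (8 * M ^ 2 * J + 1)); [lra|].
    unfold e3. apply Req_le. field. lra. }
  assert (Hf : forall x y, in_disc (x, y) -> m ^ 2 <= cfactor l (/ s0 ^ 2) (8 * M ^ 2) e a b x y).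
  { intros x y _. unfold cfactor.
    pose proof (phi_lower l (/ s0 ^ 2) _ _ _ Hl HK (sphere_eq a b x y H)) as HP.
    set (ph := phi _ _ _ _ _) in *.
    assert (0 <= 8 * M ^ 2 * e ^ 2 * X3 x y ^ 2).
    { pose proof (pow2_ge_0 M). pose proof (pow2_ge_0 e). pose proof (pow2_ge_0 (X3 x y)).
      apply Rmult_le_pos; [apply Rmult_le_pos|]; lra. }
    assert (e * (2 / l ^ 2) <= (1 - m ^ 2) / 2).
    { apply Rle_trans with (e2 * (2 / l ^ 2)).
      - apply Rmult_le_compat_r; [apply Rlt_le, Rdiv_lt_0_compat; lra | exact Le2].
      - unfold e2. apply Req_le. field. lra. }
    assert (e * (- (2 / l ^ 2)) <= e * ph) by (apply Rmult_le_compat_l; lra).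
    lra. }
  assert (Sh : smooth2 (fun x y => cfactor l (/ s0 ^ 2) (8 * M ^ 2) e a b x y * sph_density x y)).
  { apply smooth2_mult; [apply cfactor_smooth; assumption | apply sph_density_smooth]. }
  assert (Ph : forall x y, in_disc (x, y) -> 0 < cfactor l (/ s0 ^ 2) (8 * M ^ 2) e a b x y * sph_density x y).
  { intros x y Hxy. apply Rmult_lt_0_compat; [|apply Hsig].
    pose proof (Hf x y Hxy). assert (0 < m ^ 2) by (apply pow_lt; lra). lra. }
  exists (cmetric l (/ s0 ^ 2) (8 * M ^ 2) e a b). split; [|split].
  - unfold cmetric, conformal. repeat split; simpl gE; simpl gF; simpl gG.
    + exact Sh.
    + apply smooth2_const.
    + exact Sh.
    + apply Ph; assumption.
    + pose proof (Ph x y H0) as HP. replace (0 ^ 2) with 0 by ring. rewrite Rminus_0_r. exact (Rmult_lt_0_compat _ _ HP HP).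
  - change (area_g (cmetric l (/ s0 ^ 2) (8 * M ^ 2) e a b)) with
      (disc_int (fun x y => sqrt (cfactor l (/ s0 ^ 2) (8 * M ^ 2) e a b x y * sph_density x y *
        (cfactor l (/ s0 ^ 2) (8 * M ^ 2) e a b x y * sph_density x y) - 0 ^ 2))).
    (* The determinant is the square of the positive conformal density, so the area is an exact
       quadratic polynomial in [e]. *)
    rewrite (disc_int_ext _ (fun x y => sph_density x y + (2 * e * F x y + 8 * M ^ 2 * e ^ 2 * Z x y))).
    + rewrite (disc_int_plus sph_density (fun x y => 2 * e * F x y + 8 * M ^ 2 * e ^ 2 * Z x y)).
      * rewrite (disc_int_plus (fun x y => 2 * e * F x y) (fun x y => 8 * M ^ 2 * e ^ 2 * Z x y)).
        -- rewrite !disc_int_scal by assumption. rewrite disc_int_sph_density. fold I J. nra.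
        -- apply continuous2_mult; [apply smooth2_continuous2; smooth | exact CF].
        -- apply continuous2_mult; [apply smooth2_continuous2; smooth | exact CZ].
      * apply smooth2_continuous2, sph_density_smooth.
      * apply continuous2_plus; (apply continuous2_mult; [apply smooth2_continuous2; smooth | assumption]).
    + intros x y Hxy. pose proof (Ph x y Hxy) as HP.
      replace (0 ^ 2) with 0 by ring. rewrite Rminus_0_r, sqrt_square by lra.
      unfold cfactor, F, Z. ring.
  - intros c s c1 c2 p p' Hcs Hp Hp' Hc gap. split.
    + intros Hs. apply (length_ge_strong l s0 e a b c s); try assumption; lra.
    + apply length_ge_weak; try assumption; lra.
Qed.

(** * From the deficient antipodal pair to the filling inequality *)

Definition antipode (p : R * R) : R * R := (- fst p, - snd p).

Lemma antipode_on_circle (p : R * R) : on_circle p -> on_circle (antipode p).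
Proof. unfold on_circle, antipode; simpl; intros; lra. Qed.

(** Every [q] lies on a round geodesic from [p] to its antipode, so the triangle inequality carries
    a strict loss at [(p, q)] over to the antipodal pair. *)
Lemma antipodal_gap (d : R * R -> R * R -> R) : is_metric_S1 d ->
  (forall p q, on_circle p -> on_circle q -> d p q <= d_S1 p q) ->
  (exists p q, on_circle p /\ on_circle q /\ d p q <> d_S1 p q) ->
  exists p, on_circle p /\ d p (antipode p) < PI.
Proof.
  intros [_ [_ [_ Ht]]] Hle [p [q [Hp [Hq Hne]]]]. exists p. split; [exact Hp|].
  pose proof (antipode_on_circle p Hp) as Hp'.
  pose proof (Ht p q _ Hp Hq Hp') as T.
  pose proof (Hle p q Hp Hq) as L1. pose proof (Hle q _ Hq Hp') as L2.
  unfold d_S1, antipode in L2; simpl in L2.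
  replace (fst q * - fst p + snd q * - snd p) with (- (fst p * fst q + snd p * snd q)) in L2 by ring.
  rewrite acos_opp in L2. unfold d_S1 in *. fold (antipode p) in *.
  unfold antipode in *. lra.
Qed.

Lemma asin_ge (x al : R) : 0 <= al <= PI / 2 -> cos al <= x <= 1 -> PI / 2 - al <= asin x.
Proof.
  intros Hal Hx. pose proof (cos_ge_0 al ltac:(lra) ltac:(lra)) as Hc.
  pose proof (asin_bound x). apply sin_incr_0; try lra.
  rewrite sin_shift, sin_asin; lra.
Qed.

(** Two points of the same open half circle are joined by an arc on which the angle [asin z] is
    monotone, so their distance is the difference of these angles. A calibration from a pole of that
    half circle detects it. *)
Lemma acos_same_side (xp zp xq zq : R) : xp ^ 2 + zp ^ 2 = 1 -> xq ^ 2 + zq ^ 2 = 1 ->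
  0 < xp * xq -> acos (xp * xq + zp * zq) = Rabs (asin zp - asin zq).
Proof.
  intros Hp Hq Hs.
  assert (Bp : -1 <= zp <= 1) by nra. assert (Bq : -1 <= zq <= 1) by nra.
  assert (E : xp * xq + zp * zq = cos (asin zp - asin zq)).
  { rewrite cos_minus, !sin_asin, !cos_asin by assumption.
    rewrite <- sqrt_mult by (unfold Rsqr; nra).
    replace ((1 - Rsqr zp) * (1 - Rsqr zq)) with ((xp * xq) ^ 2).
    - rewrite sqrt_pow2 by lra. reflexivity.
    - unfold Rsqr. replace (1 - zp * zp) with (xp ^ 2) by lra.
      replace (1 - zq * zq) with (xq ^ 2) by lra. ring. }
  rewrite E. pose proof (asin_bound zp). pose proof (asin_bound zq).
  unfold Rabs. destruct (Rcase_abs (asin zp - asin zq)).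
  - rewrite <- cos_neg. apply acos_cos. lra.
  - apply acos_cos. lra.
Qed.

Lemma dot_frame (a b : R) (p q : R * R) : a ^ 2 + b ^ 2 = 1 ->
  fst p * fst q + snd p * snd q =
  along a b (fst p) (snd p) * along a b (fst q) (snd q)
  + across a b (fst p) (snd p) * across a b (fst q) (snd q).
Proof.
  intros H. unfold along, across.
  transitivity ((a ^ 2 + b ^ 2) * (fst p * fst q + snd p * snd q)); [rewrite H|]; ring.
Qed.

Theorem theorem1p1 (d : R * R -> R * R -> R) :
  is_metric_S1 d ->
  (forall p q, on_circle p -> on_circle q -> d p q <= d_S1 p q) ->
  (exists p q, on_circle p /\ on_circle q /\ d p q <> d_S1 p q) ->
  Rbar_lt (Fill d) (Finite (2 * PI)).
Proof.
  intros Hd Hle Hne.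
  destruct (antipodal_gap d Hd Hle Hne) as [[a b] [H0 Hgap]].
  destruct Hd as [_ [_ [Hsym Htri]]].
  assert (H : a ^ 2 + b ^ 2 = 1) by exact H0.
  pose proof (antipode_on_circle _ H0) as H0'.
  set (p0 := (a, b)) in *. set (p1 := antipode p0) in *.
  pose proof PI_RGT_0 as HPI. pose proof PI2_1 as HPI2. pose proof PI_4 as HPI4.
  set (del := PI - d p0 p1).
  assert (Hdel : 0 < del) by (unfold del; lra).
  (* Near the axis means within angle [al]; [1 - eta] will be the loss [m]. The eighths give
     [4 al + eta PI <= del], which is what [Slack] needs. *)
  set (al := Rmin 1 (del / 8)).
  assert (Hal : 0 < al) by (apply Rmin_glb_lt; lra).
  assert (Hal1 : al <= 1) by apply Rmin_l. assert (Hal2 : al <= del / 8) by apply Rmin_r.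
  set (eta := Rmin (1 / 2) (del / 8)).
  assert (Heta : 0 < eta) by (apply Rmin_glb_lt; lra).
  assert (Heta1 : eta <= 1 / 2) by apply Rmin_l. assert (Heta2 : eta <= del / 8) by apply Rmin_r.
  assert (Hsin : 0 < sin al) by (apply sin_gt_0; lra).
  destruct (pinched_metric a b (sin al) (1 - eta) H Hsin ltac:(lra)) as [g [Hg [Ha Hlen]]].
  apply Rbar_le_lt_trans with (Finite (area_g g)); [|exact Ha].
  apply (proj1 (Glb_Rbar_correct _)). exists g. split; [exact Hg|]. split; [|reflexivity].
  intros p q Hp Hq. apply (proj2 (Glb_Rbar_correct _)).
  intros L [c1 [c2 [Hc ->]]]. simpl.
  assert (Fr : forall r, on_circle r ->
    along a b (fst r) (snd r) ^ 2 + across a b (fst r) (snd r) ^ 2 = 1).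
  { intros r Hr. rewrite along_across by exact H. exact Hr. }
  pose proof (Fr p Hp) as Fp. pose proof (Fr q Hq) as Fq.
  pose proof (dot_frame a b p q H) as Dot.
  assert (Dp0 : forall r, fst r * fst p0 + snd r * snd p0 = along a b (fst r) (snd r))
    by (intros r; unfold p0, along; simpl; ring).
  pose proof (fun c s Hcs => Hlen c s c1 c2 p q Hcs Hp Hq Hc) as LL. cbv zeta in LL. clear Hlen.
  pose proof (Hle p q Hp Hq) as Hpq.
  pose proof (Hle p p0 Hp H0) as Lp. pose proof (Hle p p1 Hp H0') as Lp'.
  pose proof (Hle p0 q H0 Hq) as Lq. pose proof (Hle p1 q H0' Hq) as Lq'.
  unfold d_S1 in Hpq, Lp, Lp', Lq, Lq'.
  rewrite Dot in Hpq. rewrite Dp0 in Lp.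
  replace (fst p * fst p1 + snd p * snd p1) with (- along a b (fst p) (snd p)) in Lp'
    by (rewrite <- Dp0; unfold p1, antipode; simpl; ring).
  replace (fst p0 * fst q + snd p0 * snd q) with (along a b (fst q) (snd q)) in Lq
    by (rewrite <- Dp0; ring).
  replace (fst p1 * fst q + snd p1 * snd q) with (- along a b (fst q) (snd q)) in Lq'
    by (rewrite <- Dp0; unfold p1, antipode; simpl; ring).
  set (xp := along a b (fst p) (snd p)) in *. set (zp := across a b (fst p) (snd p)) in *.
  set (xq := along a b (fst q) (snd q)) in *. set (zq := across a b (fst q) (snd q)) in *.
  assert (Bx : -1 <= xp * xq + zp * zq <= 1).
  { pose proof (pow2_ge_0 (xp - xq)). pose proof (pow2_ge_0 (zp - zq)).
    pose proof (pow2_ge_0 (xp + xq)). pose proof (pow2_ge_0 (zp + zq)). lra. }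
  (* The directions [(0, 1)] and [(0, -1)] orthogonal to the axis give the two signs of the
     difference of angles. *)
  assert (Same : 0 < xp * xq -> d p q <= curve_length g c1 c2).
  { intros Hs. apply Rle_trans with (1 := Hpq). rewrite (acos_same_side xp zp xq zq Fp Fq Hs).
    destruct (LL 0 1 ltac:(ring)) as [LS _]. destruct (LL 0 (-1) ltac:(ring)) as [LS' _].
    rewrite Rabs_R1 in LS. rewrite Rabs_m1 in LS'.
    assert (S1 : sin al <= 1) by apply SIN_bound. specialize (LS S1). specialize (LS' S1).
    replace (0 * xp + 1 * zp) with zp in LS by ring. replace (0 * xq + 1 * zq) with zq in LS by ring.
    replace (0 * xp + -1 * zp) with (- zp) in LS' by ring.
    replace (0 * xq + -1 * zq) with (- zq) in LS' by ring.
    rewrite !asin_opp in LS'. apply Rabs_le; lra. }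
  (* If [p] is away from the axis, calibrate from [p] itself: [asin 1 - asin <p, q>] is the round
     distance. *)
  destruct (Rle_dec (sin al) (Rabs zp)) as [Cp|Cp].
  { apply Rle_trans with (1 := Hpq). rewrite acos_asin by exact Bx.
    destruct (LL xp zp Fp) as [LS _]. specialize (LS Cp).
    replace (xp * xp + zp * zp) with 1 in LS by lra. rewrite asin_1 in LS. exact LS. }
  destruct (Rle_dec (sin al) (Rabs zq)) as [Cq|Cq].
  (* The same for [q], with direction [- q] because the bound is oriented from [p] to [q]. *)
  { apply Rle_trans with (1 := Hpq). rewrite acos_asin by exact Bx.
    destruct (LL (- xq) (- zq) ltac:(lra)) as [LS _]. rewrite Rabs_Ropp in LS. specialize (LS Cq).
    replace (- xq * xq + - zq * zq) with (- (1)) in LS by lra.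
    replace (- xq * xp + - zq * zp) with (- (xp * xq + zp * zq)) in LS by ring.
    rewrite !asin_opp, asin_1 in LS. lra. }
  assert (Sc : sin al ^ 2 + cos al ^ 2 = 1).
  { pose proof (sin2_cos2 al) as E. unfold Rsqr in E. lra. }
  assert (Hcos : 0 < cos al) by (apply cos_gt_0; lra).
  assert (Near : forall x z, x ^ 2 + z ^ 2 = 1 -> ~ sin al <= Rabs z -> cos al <= Rabs x <= 1).
  { intros x z Hxz Hz. apply Rnot_le_lt in Hz. pose proof (Rabs_pos x). pose proof (Rabs_pos z).
    rewrite <- (pow2_abs x), <- (pow2_abs z) in Hxz. split; nra. }
  pose proof (Near _ _ Fp Cp) as Np. pose proof (Near _ _ Fq Cq) as Nq.
  assert (S1 : sin al <= 1) by apply SIN_bound.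
  assert (Slack : PI - del + 2 * al <= (1 - eta) * (PI - 2 * al)).
  { assert (eta * PI <= del / 8 * 4) by (apply Rmult_le_compat; lra). nra. }
  assert (Ac : forall x, cos al <= x <= 1 -> PI / 2 - al <= asin x /\ acos x <= al).
  { intros x Hx. pose proof (asin_ge x al ltac:(lra) Hx). rewrite acos_asin by lra. lra. }
  destruct (Rlt_dec 0 xp) as [Pp|Pp]; destruct (Rlt_dec 0 xq) as [Pq|Pq].
  - apply Same. nra.
  - rewrite (Rabs_pos_eq xp) in Np by lra. rewrite (Rabs_left1 xq) in Nq by lra.
    destruct (Ac _ Np) as [A1 A2]. destruct (Ac _ Nq) as [A3 A4].
    (* Opposite ends of the axis: direction [p0] gives length at least [(1 - eta) (PI - 2 al)],
       while passing through [p0] and [p1] gives [d p q <= PI - del + 2 al]. *)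
    destruct (LL 1 0 ltac:(ring)) as [_ LW].
    replace (1 * xp + 0 * zp) with xp in LW by ring.
    replace (1 * xq + 0 * zq) with (- (- xq)) in LW by ring. rewrite asin_opp in LW.
    pose proof (Htri p p0 q Hp H0 Hq) as T1. pose proof (Htri p0 p1 q H0 H0' Hq) as T2.
    assert ((1 - eta) * (PI - 2 * al) <= (1 - eta) * (asin xp - - asin (- xq)))
      by (apply Rmult_le_compat_l; lra).
    unfold del in *. lra.
  - rewrite (Rabs_left1 xp) in Np by lra. rewrite (Rabs_pos_eq xq) in Nq by lra.
    destruct (Ac _ Np) as [A1 A2]. destruct (Ac _ Nq) as [A3 A4].
    destruct (LL (-1) 0 ltac:(ring)) as [_ LW].
    replace (-1 * xp + 0 * zp) with (- xp) in LW by ring.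
    replace (-1 * xq + 0 * zq) with (- xq) in LW by ring. rewrite (asin_opp xq) in LW.
    pose proof (Htri p p1 q Hp H0' Hq) as T1. pose proof (Htri p1 p0 q H0' H0 Hq) as T2.
    rewrite (Hsym p1 p0 H0' H0) in T2.
    assert ((1 - eta) * (PI - 2 * al) <= (1 - eta) * (asin (- xp) - - asin xq))
      by (apply Rmult_le_compat_l; lra).
    unfold del in *. lra.
  - apply Same. rewrite (Rabs_left1 xp) in Np by lra. rewrite (Rabs_left1 xq) in Nq by lra. nra.
Qed.
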